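(* Let $d\ge 2$, let $\mathcal D\subset\mathbb R^d$ be a bounded domain with $C^{1,1}$ boundary and $0\in\mathcal D$, let $c:\mathcal D\to\mathbb R$ be bounded and continuous, and let $\Psi\in\mathcal B_0$ (with zero drift) satisfy the WLSC property. Suppose that the principal eigenvalue $\lambda_{\mathcal D}$ of $-\Psi(-\Delta)+c$ in $\mathcal D$ satisfies $\lambda_{\mathcal D}<0$, and let $v\in C_{\rm b}(\mathbb R^d)$ be a viscosity sub-solution of $$-\Psi(-\Delta)v+c\,v=0\quad\text{in }\mathcal D,\qquad\text{with}\qquad v\le 0\quad\text{in }\mathcal D^c .$$ Then $v\le 0$ in $\mathbb R^d$.
   Context: A Bernstein function is $\Psi\in C^\infty((0,\infty))$ with $\Psi\ge 0$ and $(-1)^n\Psi^{(n)}\le 0$ for all $n\ge1$; $\mathcal B_0$ is the set of Bernstein functions with $\lim_{x\downarrow 0}\Psi(x)=0$. Zero drift means $\Psi(x)=\int_{(0,\infty)}(1-e^{-yx})\,\mathfrak m(dy)$ for a Borel measure $\mathfrak m$ on $(0,\infty)$ with $\int (y\wedge 1)\,\mathfrak m(dy)<\infty$. Set $j(r)=\int_0^\infty(4\pi t)^{-d/2}e^{-r^2/(4t)}\,\mathfrak m(dt)$, $r>0$; it is assumed that $j:(0,\infty)\to(0,\infty)$ (i.e. $\Psi\not\equiv 0$). WLSC (weak lower scaling): there are $\underline\mu>0$, $\underline c\in(0,1]$, $\underline\theta\ge 0$ with $\Psi(\gamma x)\ge\underline c\,\gamma^{\underline\mu}\Psi(x)$ for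 all $x>\underline\theta$, $\gamma\ge 1$. $C_{\rm b}(\mathbb R^d)$ is the space of bounded continuous functions on $\mathbb R^d$; $C_{{\rm b},+}(\mathcal D)$ is the set of non-negative functions in $C_{\rm b}(\mathbb R^d)$ that are positive in $\mathcal D$. $C^2_{\rm b}(x)$ is the set of bounded (Borel) functions on $\mathbb R^d$ that are twice continuously differentiable in a neighbourhood of $x$. For $\varphi\in C^2_{\rm b}(x)$, $$-\Psi(-\Delta)\varphi(x)=\tfrac12\int_{\mathbb R^d}\big(\varphi(x+z)+\varphi(x-z)-2\varphi(x)\big)j(|z|)\,dz .$$ Viscosity sub/super-solutions: for $a,h:\mathcal D\to\mathbb R$, $u\in C_{\rm b}(\mathbb R^d)$ is a viscosity sub-solution of $-\Psi(-\Delta)u+a\,u=h$ in $\mathcal D$ if for every $x\in\mathcal D$ and every $\varphi\in C^2_{\rm b}(x)$ with $\varphi(x)=u(x)$ and $\varphi(y)>u(y)$ for $y\ne x$, one has $-\Psi(-\Delta)\varphi(x)+a(x)u(x)\ge h(x)$. It is a viscosity super-solution (written $-\Psi(-\Delta)u+a\,u\le h$) if for every $x\in\mathcal D$ and $\varphi\in C^2_{\rm b}(x)$ with $\varphi(x)=u(x)$ and $\varphi(y)<u(y)$ for $y\neq x$, one has $-\Psi(-\Delta)\varphi(x)+a(x)u(x)\le h(x)$. Principal eigenvalue: $\lambda_{\mathcal D}=\inf\{\lambda\in\mathbb R:\exists\,\psi\in C_{{\rm b},+}(\mathcal D)\text{ such that }-\Psi(-\Delta)\psi+c\,\psi\le\lambda\psi\text{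 in }\mathcal D\}$, where the inequality is in the viscosity (super-solution) sense, i.e. with $a=c-\lambda$, $h=0$. *)

(* Defs.v *)
From HB Require Import structures.
From mathcomp Require Import all_boot all_order all_algebra.
From mathcomp Require Import all_classical all_reals all_analysis.
From mathcomp Require Import measurable_realfun.

Set Implicit Arguments.
Unset Strict Implicit.
Unset Printing Implicit Defensive.

Import Order.TTheory GRing.Theory Num.Theory.
Import numFieldNormedType.Exports.

Local Open Scope classical_set_scope.
Local Open Scope ring_scope.

(* The topology of 'rV[R]_n is the library's one (induced by the max norm); the
   measurable sets of the alias [borelRV R n] of 'rV[R]_n are the Borel sets of
   that topology. *)
Definition borelRV (R : realType) (n : nat) :=
  g_sigma_algebraType (@open 'rV[R]_n).

Section lebesgue_measure_on_Rn.
Context {R : realType}.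

Definition rVcons (n : nat) (p : measurableTypeR R * borelRV R n) :
    borelRV R n.+1 :=
  \row_(i < n.+1) if unlift ord0 i is Some j then (p.2 : 'rV[R]_n) ord0 j
                   else p.1.

Lemma open_measurable_rV (n : nat) (U : set 'rV[R]_n) :
  open U -> measurable (U : set (borelRV R n)).
Proof. by move=> oU; exact: sub_sigma_algebra. Qed.

Lemma open_rat_ball (n : nat) (U : set 'rV[R]_n) : open U ->
  U = \bigcup_(qr in [set qr : 'rV[rat]_n * rat | 0 < qr.2 /\
                       ball (map_mx ratr qr.1 : 'rV[R]_n) (ratr qr.2) `<=` U])
        ball (map_mx ratr qr.1 : 'rV[R]_n) (ratr qr.2).
Proof.
move=> oU; apply/seteqP; split => [x Ux|x [qr /= [_ qrU]]]; last exact: qrU.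
have /nbhs_ballP[e /= e0 eU] : nbhs x U by exact: open_nbhs_nbhs.
have [r] : exists r : rat, ratr r \in `]0, (e / 2)%R[.
  by apply: rat_in_itvoo; rewrite divr_gt0.
rewrite in_itv/= => /andP[r0 re].
have qP (i : 'I_n) : exists q : rat, ratr q \in `](x ord0 i), (x ord0 i + ratr r)%R[.
  by apply: rat_in_itvoo; rewrite ltrDl.
pose q : 'rV[rat]_n := \row_i projT1 (cid (qP i)).
have xq (i : 'I_n) : `|x ord0 i - ratr (q ord0 i)| < ratr r.
  rewrite mxE; case: cid => s /=; rewrite in_itv/= => /andP[s1 s2].
  by rewrite distrC gtr0_norm ?subr_gt0// ltrBlDl.
have qx : ball (map_mx ratr q : 'rV[R]_n) (ratr r) x.
  split=> // i j; rewrite (ord1 i) mxE /ball/= distrC.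
  exact: xq.
exists (q, r) => //=; split; first by move: r0; rewrite ltr0q.
move=> y qy; apply: eU.
apply: (@le_ball _ _ _ (ratr r + ratr r)); first by rewrite [leRHS]splitr lerD// ltW.
by apply: ball_triangle qy; exact: ball_sym.
Qed.

Lemma measurable_rVcons (n : nat) : measurable_fun setT (@rVcons n).
Proof.
apply: (@measurability _ _ _ _ setT (@rVcons n) (@open 'rV[R]_n.+1)) => //.
move=> _ [U oU <-]; rewrite setTI (open_rat_ball oU) preimage_bigcup.
rewrite bigcup_mkcond; apply: countable_bigcupT_measurable; first exact: countableP.
move=> [q r]; case: ifPn => // /set_mem[/= r0 _].
rewrite (_ : _ @^-1` _ = (ball (ratr (q ord0 ord0) : R) (ratr r) : set (measurableTypeR R)) `*`
    (ball (map_mx ratr (\row_i q ord0 (lift ord0 i)) : 'rV[R]_n) (ratr r) : set (borelRV R n))).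
  apply: measurableX; first exact: measurable_ball.
  by apply: open_measurable_rV; exact: ball_open.
have r0' : 0 < ratr r :> R by rewrite ltr0q.
have rV0 (x : R) (v : 'rV[R]_n) : @rVcons n (x, v) ord0 ord0 = x.
  by rewrite mxE unlift_none.
have rVS (x : R) (v : 'rV[R]_n) i : @rVcons n (x, v) ord0 (lift ord0 i) = v ord0 i.
  by rewrite mxE liftK.
apply/seteqP; split => -[x v] /=.
  move=> [_ H]; split => /=.
    by have := H ord0 ord0; rewrite rV0 mxE.
  by split=> // i j; have := H ord0 (lift ord0 j); rewrite rVS !mxE (ord1 i).
move=> [/= H1 [_ H2]]; split => // i j; rewrite (ord1 i) mxE.
case: (unliftP ord0 j) => [k ->|->].
  by rewrite rVS; have := H2 ord0 k; rewrite !mxE.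
by rewrite rV0.
Qed.

Definition rVuncons (n : nat) (v : borelRV R n.+1) :
    measurableTypeR R * borelRV R n :=
  ((v : 'rV[R]_n.+1) ord0 ord0, \row_i (v : 'rV[R]_n.+1) ord0 (lift ord0 i)).

Lemma rVconsK (n : nat) : cancel (@rVcons n) (@rVuncons n).
Proof.
move=> [x v]; rewrite /rVuncons; congr pair.
  by rewrite mxE unlift_none.
by apply/rowP => i; rewrite !mxE liftK.
Qed.

Lemma measurable_rVuncons (n : nat) : measurable_fun setT (@rVuncons n).
Proof.
apply: measurable_fun_pair => /=.
  apply: (measurability _ (RGenOpens.measurableE R)).
  move=> _ [_ [a [b ->] <-]]; rewrite setTI; apply: open_measurable_rV.
  apply: (@open_comp 'rV[R]_n.+1 R (fun v => v ord0 ord0)); last exact: interval_open.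
  move=> v _.
  exact: coord_continuous.
apply: (@measurability _ _ (borelRV R n.+1) (borelRV R n) setT
  (fun v : 'rV[R]_n.+1 => \row_i v ord0 (lift ord0 i)) (@open 'rV[R]_n)) => //.
move=> _ [U oU <-]; rewrite setTI; apply: open_measurable_rV.
apply: (@open_comp 'rV[R]_n.+1 'rV[R]_n
  (fun v => \row_i v ord0 (lift ord0 i))) => // v _.
move=> A /nbhs_ballP[e /= e0 eA]; apply/nbhs_ballP; exists e => //= w [_ vw].
by apply: eA; split=> // i j; rewrite !mxE; exact: vw.
Qed.

Section rVcons_measure.
Variables (n : nat) (mu : {sigma_finite_measure set (borelRV R n) -> \bar R}).

Definition rVcons_measure : set (borelRV R n.+1) -> \bar R :=
  pushforward (@lebesgue_measure R \x mu)%E (@rVcons n).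

Let rVcons_measure0 : rVcons_measure set0 = 0%E.
Proof. by rewrite /rVcons_measure /pushforward preimage_set0 measure0. Qed.

Let rVcons_measure_ge0 A : (0 <= rVcons_measure A)%E.
Proof. by rewrite /rVcons_measure /pushforward measure_ge0. Qed.

Let rVcons_measure_sigma_additive : semi_sigma_additive rVcons_measure.
Proof.
move=> F mF tF mUF; rewrite /rVcons_measure /pushforward preimage_bigcup.
have mp A : measurable A -> measurable (@rVcons n @^-1` A).
  by move=> mA; rewrite -[X in measurable X]setTI; exact: measurable_rVcons.
apply: measure_semi_sigma_additive.
- by move=> i; exact: mp.
- by move=> i j _ _ [p [/= Fip Fjp]]; apply: (tF i j) => //; exists (@rVcons n p).
- by rewrite -preimage_bigcup; exact: mp.
Qed.

HB.instance Definition _ := isMeasure.Build _ _ _ rVcons_measure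
  rVcons_measure0 rVcons_measure_ge0 rVcons_measure_sigma_additive.

Let rVcons_measure_sigma_finite : sigma_finite setT rVcons_measure.
Proof.
have [F TF Ffin] : sigma_finite setT (@lebesgue_measure R \x mu)%E.
  have /sigma_finiteP[F [TF ndF Foo]] := sigma_finiteT (@lebesgue_measure R).
  have /sigma_finiteP[G [TG ndG Goo]] := sigma_finiteT mu.
  exists (fun k => F k `*` G k).
    rewrite -setXTT TF TG; apply/seteqP; split => -[x v].
      move=> [/= [i _ Fix] [k _ Gkv]]; exists (maxn i k) => //; split.
      - by move: x Fix; exact/subsetPset/ndF/leq_maxl.
      - by move: v Gkv; exact/subsetPset/ndG/leq_maxr.
    by move=> [i _ []/= ? ?]; split; exists i.
  move=> k; have [? ?] := Foo k; have [? ?] := Goo k.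
  split; first exact: measurableX.
  by rewrite product_measure1E// lte_mul_pinfty// ge0_fin_numE.
exists (fun k => @rVuncons n @^-1` F k).
  by rewrite -preimage_bigcup -TF preimage_setT.
move=> k; have [mF Foo] := Ffin k; split.
  by rewrite -[X in measurable X]setTI; exact: measurable_rVuncons.
rewrite /rVcons_measure /pushforward -comp_preimage.
by rewrite (_ : _ \o _ = id) ?preimage_id//; apply/funext => p; exact: rVconsK.
Qed.

HB.instance Definition _ := Measure_isSigmaFinite.Build _ _ _
  rVcons_measure rVcons_measure_sigma_finite.

End rVcons_measure.

(* Lebesgue measure on the Borel sets of R^n, as the n-fold product of the
   one-dimensional Lebesgue measure; the base case is the unit mass on the
   one-point space R^0. *)
Fixpoint lebesgueRV (n : nat) :
    {sigma_finite_measure set (borelRV R n) -> \bar R} :=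
  match n with
  | 0 => @dirac _ (borelRV R 0) (0 : 'rV[R]_0) R
  | n'.+1 => rVcons_measure (lebesgueRV n')
  end.

Lemma closed_measurable_rV (n : nat) (A : set 'rV[R]_n) :
  closed A -> measurable (A : set (borelRV R n)).
Proof.
move=> cA; rewrite -(setCK A); apply: measurableC.
by apply: open_measurable_rV; rewrite openC.
Qed.

Lemma closed_box (n : nat) (a b : 'rV[R]_n) :
  closed [set x : 'rV[R]_n | forall i, x ord0 i \in `[a ord0 i, b ord0 i]].
Proof.
rewrite (_ : mkset _ = \bigcap_(i in [set: 'I_n])
    (fun x : 'rV[R]_n => x ord0 i) @^-1` `[a ord0 i, b ord0 i]); last first.
  by apply/seteqP; split => x /= H i; [move=> _|]; exact: H.
apply: closed_bigI => i _; apply: (@closed_comp _ _ (fun x : 'rV[R]_n => x ord0 i)).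
  by move=> v _; exact: coord_continuous.
exact: interval_closed.
Qed.

Lemma lebesgueRV_box (n : nat) (a b : 'rV[R]_n) :
  (forall i, a ord0 i <= b ord0 i) ->
  lebesgueRV n [set x : 'rV[R]_n | forall i, x ord0 i \in `[a ord0 i, b ord0 i]] =
  (\prod_i (b ord0 i - a ord0 i))%:E.
Proof.
elim: n a b => [|n IH] a b ab.
  by rewrite big_ord0 /= diracE mem_set// => -[].
pose tl (v : 'rV[R]_n.+1) : 'rV[R]_n := \row_i v ord0 (lift ord0 i).
rewrite /= /rVcons_measure /pushforward.
set B := (X in (_ \x _)%E X).
have -> : B = (`[a ord0 ord0, b ord0 ord0]%classic : set (measurableTypeR R)) `*`
    ([set x : 'rV[R]_n | forall i, x ord0 i \in `[tl a ord0 i, tl b ord0 i]]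
      : set (borelRV R n)).
  apply/seteqP; split => -[x v] /=.
    move=> H; split => /=; first by have := H ord0; rewrite mxE unlift_none.
    by move=> i; have := H (lift ord0 i); rewrite !mxE liftK.
  move=> [/= H1 H2] i; rewrite mxE.
  case: (unliftP ord0 i) => [k ->|->] //=.
  by have := H2 k; rewrite !mxE.
rewrite product_measure1E//; last first.
  by apply: closed_measurable_rV; exact: closed_box.
rewrite [X in (_ * X)%E](IH (tl a) (tl b)); last by move=> i; rewrite !mxE.
have /= itvE := @lebesgue_measure_itv R `[a ord0 ord0, b ord0 ord0].
rewrite [X in (X * _)%E]itvE lte_fin big_ord_recl EFinM.
congr (_ * _)%E; last by congr EFin; apply: eq_bigr => i _; rewrite !mxE.
have := ab ord0; rewrite le_eqVlt => /orP[/eqP ->|->//].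
by rewrite ltxx subrr.
Qed.

End lebesgue_measure_on_Rn.

Section bernstein_functions.
Context {R : realType}.
Implicit Types (Psi : R -> R) (m : {measure set (measurableTypeR R) -> \bar R}).

Definition bernstein Psi :=
  [/\ forall n x, 0 < x -> derivable (derive1n n Psi) x 1,
      forall x, 0 < x -> 0 <= Psi x &
      forall n x, (1 <= n)%N -> 0 < x -> (-1) ^+ n * derive1n n Psi x <= 0].

Definition bernstein0 Psi := bernstein Psi /\ Psi x @[x --> 0^'+] --> 0.

(* A Borel measure on (0,oo) is given by a Borel measure m on R of which only
   the restriction to (0,oo) is ever used. *)
Definition zero_drift Psi m :=
  (\int[m]_(y in `]0%R, +oo[) (Num.min y 1)%:E < +oo)%E /\
  forall x, 0 < x ->
    (Psi x)%:E = (\int[m]_(y in `]0%R, +oo[) (1 - expR (- (y * x)))%:E)%E.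

Definition jump_density (d : nat) m (r : R) : R :=
  \int[m]_(t in `]0, +oo[)
    ((4 * pi * t) `^ (- (d%:R / 2)) * expR (- (r ^+ 2 / (4 * t)))).

Definition WLSC Psi :=
  exists mu c theta : R, [/\ 0 < mu, 0 < c <= 1, 0 <= theta &
    forall x gamma, theta < x -> 1 <= gamma ->
      c * gamma `^ mu * Psi x <= Psi (gamma * x)].

End bernstein_functions.

Section euclidean_space.
Context {R : realType} {d : nat}.
Implicit Types (D : set 'rV[R]_d) (u phi : 'rV[R]_d -> R).

Definition enorm (z : 'rV[R]_d) : R := Num.sqrt (\sum_i z ord0 i ^+ 2).

Definition partial (i : 'I_d) phi : 'rV[R]_d -> R := 'D_(delta_mx 0 i) phi.

Definition grad phi (x : 'rV[R]_d) : 'rV[R]_d := \row_i partial i phi x.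

Definition domain D := [/\ open D, connected D & D !=set0].

Definition Cb u := continuous u /\ bounded_fun u.

Definition Cbplus D u :=
  [/\ Cb u, forall x, 0 <= u x & forall x, D x -> 0 < u x].

Definition C2b (x : 'rV[R]_d) phi :=
  [/\ bounded_fun phi, measurable_fun setT (phi : borelRV R d -> R) &
    \forall y \near x, [/\ differentiable phi y,
      forall i, differentiable (partial i phi) y &
      forall i j, {for y, continuous (partial j (partial i phi))}]].

End euclidean_space.

(* Near each boundary point x0, after an orthogonal change of coordinates
   x |-> (x - x0) *m Q, D is the region above the graph of a function g of the
   d - 1 coordinates other than the i-th; [col' i y] is y without its i-th
   coordinate. *)
Definition C11_boundary (R : realType) (d : nat) (D : set 'rV[R]_d) :=
  forall x0, (closure D `\` D°) x0 ->
  exists (i : 'I_d) (Q : 'M[R]_d) (g : 'rV[R]_d.-1 -> R) (r : R),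
    [/\ Q *m Q^T = 1%:M,
        (forall y, differentiable g y) /\ lipschitz (grad g),
        0 < r &
        forall x, enorm (x - x0) < r ->
          let y := (x - x0) *m Q in D x <-> g (col' i y) < y ord0 i].

Section viscosity.
Context {R : realType} {d : nat}.
Variable m : {measure set (measurableTypeR R) -> \bar R}.
Implicit Types (D : set 'rV[R]_d) (a h u phi : 'rV[R]_d -> R).

(* The operator -Psi(-Delta), for Psi the Bernstein function with zero drift and
   measure m. The integral converges absolutely when [C2b x phi], because
   (1 /\ |z|^2) j(|z|) is integrable. *)
Definition mPsi_mLaplace phi (x : 'rV[R]_d) : R :=
  2^-1 * \int[lebesgueRV d]_z
    ((phi (x + z) + phi (x - z) - 2 * phi x) * jump_density d m (enorm z)).

Definition viscosity_sub D a h u :=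
  forall x phi, D x -> C2b x phi -> phi x = u x ->
    (forall y, y != x -> u y < phi y) ->
    h x <= mPsi_mLaplace phi x + a x * u x.

Definition viscosity_super D a h u :=
  forall x phi, D x -> C2b x phi -> phi x = u x ->
    (forall y, y != x -> phi y < u y) ->
    mPsi_mLaplace phi x + a x * u x <= h x.

(* An infimum in the extended reals, so that it is -oo (rather than a default
   value) if the set is unbounded below. *)
Definition principal_eigenvalue D (c : 'rV[R]_d -> R) : \bar R :=
  ereal_inf [set lam%:E | lam in [set lam : R | exists psi,
    Cbplus D psi /\ viscosity_super D (fun x => c x - lam) (cst 0) psi]].

End viscosity.

(* Main.v *)
From HB Require Import structures.
Require Import Defs.
From mathcomp Require Import all_boot all_order all_algebra.
From mathcomp Require Import all_classical all_reals all_analysis.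
From mathcomp Require Import measurable_realfun ring lra.

Set Implicit Arguments.
Unset Strict Implicit.
Unset Printing Implicit Defensive.

Import Order.TTheory GRing.Theory Num.Theory.
Import numFieldNormedType.Exports.

Local Open Scope classical_set_scope.
Local Open Scope ring_scope.

(** Let [lam < 0] and let [psi] be a supersolution for [c - lam] that is positive
    in [D]. By WLSC, [Psi] is unbounded, so the kernel [j(|z|) dz] has infinite
    mass near the origin; as [j] is bounded away from the origin, there are a radius
    [r0] and a compact [K] in [D] such that, from every point, the jumps longer than
    [r0] that land outside the thin set [D \ K] have mass at least [2 sup |c|].
    Now let [t > 0] and suppose that [w = v - t psi] is nonpositive on [K]; it is
    nonpositive off [D] too. If [w] had a maximum [M >= 0] at [x0] in [D], then
    doubling of variables would give
      [0 <= c(x0) M + t lam psi(x0) - (M / 2) 2 sup |c| < 0].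
    Hence [w <= 0] everywhere, with strict inequality in [D]. For [t] the maximum of
    [v / psi] over [K], if positive, this contradicts [w = 0] at the maximiser; so
    [v <= 0] on [K], every [t > 0] is admissible, and [v <= 0]. *)

(** * Lebesgue measure on R^n *)

(** The ratio [v / psi] need not attain a maximum over [D], since nothing prevents [psi] from
    vanishing at the boundary faster than [v]. It is therefore maximised over a compact [K] only,
    and the thin rest of [D] is left to a maximum principle whose strength comes from long jumps.
    The operator is symmetrised: of the two jumps [z] and [- z] from a maximum, only one is known to
    land where [w <= 0], and the other is merely bounded by maximality. This halves the gain, whence
    a mass of [2 sup |c|] to absorb [c(x0) M]. What remains, [t lam psi(x0)], is negative whatever
    [M] is, so the argument survives at [M = 0], exactly the value met at the maximiser of the
    ratio. As neither [v] nor [psi] is smooth, their viscosity inequalities cannot be subtracted at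
    a common point; they are tested at two nearby points instead. Both points jump by the same
    vector, which leaves the coupling penalty unchanged, so that its size never has to be
    estimated. *)

Section lebesgueRV_theory.
Context {R : realType}.

Lemma continuous_measurable_rV (n : nat) (f : 'rV[R]_n -> R) :
  continuous f -> measurable_fun setT (f : borelRV R n -> R).
Proof.
move=> cf; apply: (measurability _ (RGenOpens.measurableE R)).
move=> _ [_ [a [b ->] <-]]; rewrite setTI; apply: open_measurable_rV.
by apply: open_comp; [move=> x _; exact: cf|exact: interval_open].
Qed.

Lemma continuous_measurable_rVrV (n k : nat) (f : 'rV[R]_n -> 'rV[R]_k) :
  continuous f -> measurable_fun setT (f : borelRV R n -> borelRV R k).
Proof.
move=> cf; apply: (@measurability _ _ (borelRV R n) (borelRV R k) setT f
  (@open 'rV[R]_k)) => //.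
move=> _ [U oU <-]; rewrite setTI; apply: open_measurable_rV.
by apply: open_comp => // x _; exact: cf.
Qed.

Lemma continuous_shift (n : nat) (a : 'rV[R]_n) :
  continuous (fun z : 'rV[R]_n => a + z).
Proof.
move=> x; rewrite /continuous_at.
apply: (@cvgD R 'rV[R]_n 'rV[R]_n (nbhs (x : 'rV[R]_n)) _ (fun=> a) id a x).
  exact: cvg_cst.
exact: cvg_id.
Qed.

Lemma continuous_reflect (n : nat) (a : 'rV[R]_n) :
  continuous (fun z : 'rV[R]_n => a - z).
Proof.
move=> x; rewrite /continuous_at.
apply: (@cvgB R 'rV[R]_n 'rV[R]_n (nbhs (x : 'rV[R]_n)) _ (fun=> a) id a x).
  exact: cvg_cst.
exact: cvg_id.
Qed.

Lemma lebesgue_measure_shift (a : R) (A : set (measurableTypeR R)) :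
  measurable A ->
  lebesgue_measure ((fun x : R => a + x) @^-1` A) = lebesgue_measure A.
Proof.
have mT : measurable_fun setT
    ((fun x => a + x) : measurableTypeR R -> measurableTypeR R).
  by apply: measurable_funD => //; exact: measurable_id.
move=> mA; pose nu : {measure set (measurableTypeR R) -> \bar R} :=
  @measure_function_pushforward__canonical__measure_function_Measure _ _ _ _ _
    (@lebesgue_measure R) _ mT.
rewrite (@lebesgue_measure_unique R nu _ A mA)// => X [[x y] /= _ <-].
rewrite /nu/= /pushforward.
have -> : (fun x : R => a + x) @^-1` `]x, y]%classic = `]x - a, y - a]%classic.
  by apply/seteqP; split => z /=; rewrite !in_itv/= lerBrDl ltrBlDl.
rewrite !lebesgue_measure_itv/= !lte_fin ltrD2r; case: ifPn => // _.
by rewrite -!EFinD; congr EFin; ring.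
Qed.

(** A translation acts separately on the two components of [rVcons], so uniqueness of the product
    measure on rectangles reduces the claim to the line. The invariance makes the estimates near the
    boundary uniform in the starting point of a jump. *)
Lemma lebesgueRV_shift (n : nat) (a : 'rV[R]_n) (A : set (borelRV R n)) :
  measurable A ->
  lebesgueRV n ((fun z : 'rV[R]_n => a + z) @^-1` A) = lebesgueRV n A.
Proof.
elim: n a A => [|n IH] a A mA.
  have a0 (z : 'rV[R]_0) : a + z = z by apply/rowP => -[].
  by rewrite (_ : _ @^-1` A = A)//; apply/seteqP; split => z /=; rewrite a0.
pose tl : 'rV[R]_n := \row_i a ord0 (lift ord0 i).
pose S (p : measurableTypeR R * borelRV R n) : measurableTypeR R * borelRV R n :=
  (a ord0 ord0 + p.1, tl + p.2 : 'rV[R]_n).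
have mS1 : measurable_fun setT
    ((fun x => a ord0 ord0 + x) : measurableTypeR R -> measurableTypeR R).
  by apply: measurable_funD => //; exact: measurable_id.
have mS2 : measurable_fun setT
    ((fun z => tl + z) : borelRV R n -> borelRV R n).
  by apply: continuous_measurable_rVrV; exact: continuous_shift.
have mS : measurable_fun setT S.
  apply: measurable_fun_pair => /=.
    exact: (measurableT_comp mS1 measurable_fst).
  exact: (measurableT_comp mS2 measurable_snd).
rewrite /= /rVcons_measure /pushforward.
have -> : @rVcons R n @^-1` ((fun z : 'rV[R]_n.+1 => a + z) @^-1` A) =
    S @^-1` (@rVcons R n @^-1` A).
  have e p : a + rVcons p = rVcons (S p).
    apply/rowP => i; rewrite !mxE; case: (unliftP ord0 i) => [j ->|->] //=.
    by rewrite !mxE.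
  by apply/seteqP; split => p /=; rewrite e.
have mA' : measurable (@rVcons R n @^-1` A).
  by rewrite -[X in measurable X]setTI; exact: measurable_rVcons.
pose nu : {measure set (measurableTypeR R * borelRV R n) -> \bar R} :=
  @measure_function_pushforward__canonical__measure_function_Measure _ _ _ _ _
    (@lebesgue_measure R \x lebesgueRV n)%E _ mS.
rewrite (@product_measure_unique _ _ _ _ _ _ _ nu _ _ mA')// => B C mB mC.
rewrite /nu/= /pushforward.
have -> : S @^-1` (B `*` C) =
    ((fun x : R => a ord0 ord0 + x) @^-1` B) `*`
    ((fun z : 'rV[R]_n => tl + z) @^-1` C) by [].
rewrite product_measure1E.
- congr (_ * _)%E; first exact: lebesgue_measure_shift.
  exact: IH.
- by rewrite -[X in measurable X]setTI; exact: mS1.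
- by rewrite -[X in measurable X]setTI; exact: mS2.
Qed.

End lebesgueRV_theory.

(** * Gaussian integrals on R^n *)

Section gaussian.
Context {R : realType}.

Lemma measurable_expR_oppdiv (s : R) :
  measurable_fun setT (fun y : R => expR (- (y / s))).
Proof.
apply: measurableT_comp; first exact: measurable_expR.
by apply: measurable_funN; exact: measurable_funM.
Qed.

(** This is the normalisation of the centred normal density of variance [s / 2]. *)
Lemma integral_gauss1 (s : R) : 0 < s ->
  (\int[@lebesgue_measure R]_x (expR (- (x ^+ 2 / s)))%:E =
   (Num.sqrt (pi * s))%:E)%E.
Proof.
move=> s0.
have q0 : 0 < Num.sqrt (s / 2) by rewrite sqrtr_gt0 divr_gt0.
have q2 : Num.sqrt (s / 2) ^+ 2 *+ 2 = s.
  by rewrite sqr_sqrtr ?divr_ge0 ?ltW// -mulr_natr mulfVK.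
have p0 : 0 < Num.sqrt (pi * s) by rewrite sqrtr_gt0 mulr_gt0 ?pi_gt0.
have := integral_normal_pdf 0 (Num.sqrt (s / 2)).
rewrite /normal_pdf gt_eqF//.
have -> : normal_peak (Num.sqrt (s / 2)) = (Num.sqrt (pi * s))^-1 :> R.
  by rewrite /normal_peak -mulrnAl q2 mulrC.
under eq_integral do rewrite EFinM.
rewrite ge0_integralZl//; last 2 first.
- by apply/measurable_EFinP; exact: measurable_normal_fun.
- by move=> x _; rewrite lee_fin expR_ge0.
rewrite /normal_fun; under eq_integral do rewrite subr0 q2 mulNr.
move=> /(congr1 (fun x => (Num.sqrt (pi * s))%:E * x)%E).
by rewrite muleA -EFinM mulfV ?gt_eqF// mul1e mule1.
Qed.

Definition sqnorm (n : nat) (z : 'rV[R]_n) : R := \sum_i z ord0 i ^+ 2.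

Lemma sqnorm_ge0 n (z : 'rV[R]_n) : 0 <= sqnorm z.
Proof. by apply: sumr_ge0 => i _; exact: sqr_ge0. Qed.

Lemma sqr_enorm n (z : 'rV[R]_n) : enorm z ^+ 2 = sqnorm z.
Proof. by rewrite sqr_sqrtr// sqnorm_ge0. Qed.

Lemma continuous_sum (T : topologicalType) n (f : 'I_n -> T -> R) :
  (forall i, continuous (f i)) -> continuous (fun x => \sum_i f i x).
Proof.
move=> cf x; elim: n f cf => [|n IH] f cf.
  rewrite /continuous_at big_ord0; under eq_fun do rewrite big_ord0.
  exact: cvg_cst.
rewrite /continuous_at big_ord_recl; under eq_fun do rewrite big_ord_recl.
apply: cvgD; first exact: cf.
by apply: (IH (fun i => f (lift ord0 i))) => i; exact: cf.
Qed.

Lemma continuous_sqnorm n : continuous (@sqnorm n).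
Proof.
apply: continuous_sum => i x.
apply: (@continuous_comp _ _ _ (fun z : 'rV[R]_n => z ord0 i) (fun y : R => y ^+ 2)).
  exact: coord_continuous.
exact: exprn_continuous.
Qed.

Lemma sqnorm_rVcons n (p : measurableTypeR R * borelRV R n) :
  sqnorm (@rVcons R n p) = p.1 ^+ 2 + sqnorm p.2.
Proof.
rewrite /sqnorm big_ord_recl mxE unlift_none; congr +%R.
by apply: eq_bigr => i _; rewrite mxE liftK.
Qed.

Lemma integral_rV0 (f : borelRV R 0 -> \bar R) :
  measurable_fun setT f -> (\int[lebesgueRV 0]_z f z = f (0%R : 'rV[R]_0))%E.
Proof. by move=> mf; rewrite /= integral_dirac// diracT mul1e. Qed.

Lemma integral_gauss n (s : R) : 0 < s ->
  (\int[lebesgueRV n]_z (expR (- (sqnorm z / s)))%:E =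
   (Num.sqrt (pi * s) ^+ n)%:E)%E.
Proof.
have m1 := measurable_expR_oppdiv s.
have mg k : measurable_fun setT
    ((fun z => (expR (- (sqnorm z / s)))%:E) : borelRV R k -> \bar R).
  apply/measurable_EFinP.
  exact: (measurableT_comp m1 (continuous_measurable_rV (@continuous_sqnorm k))).
move=> s0; elim: n => [|n IH].
  by rewrite integral_rV0// /sqnorm big_ord0 mul0r oppr0 expR0 expr0.
transitivity (\int[(@lebesgue_measure R \x lebesgueRV n)%E]_p
    (expR (- (sqnorm (@rVcons R n p) / s)))%:E)%E.
  rewrite /= /rVcons_measure.
  exact: (@ge0_integral_pushforward _ _ _ _ R _ (@measurable_rVcons R n)
    (@lebesgue_measure R \x lebesgueRV n)%E _ _ measurableT (mg n.+1)).
have e (p : measurableTypeR R * borelRV R n) :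
    (expR (- (sqnorm (@rVcons R n p) / s)))%:E =
    ((expR (- (p.1 ^+ 2 / s)))%:E * (expR (- (sqnorm p.2 / s)))%:E)%E.
  by rewrite sqnorm_rVcons mulrDl opprD expRD EFinM.
under eq_integral do rewrite e.
rewrite fubini_tonelli1/=; last 2 first.
- apply: emeasurable_funM.
    apply/measurable_EFinP; apply: (measurableT_comp m1).
    exact: (measurableT_comp (exprn_measurable 2) measurable_fst).
  exact: (measurableT_comp (mg n) measurable_snd).
- by move=> p; rewrite -EFinM lee_fin mulr_ge0// expR_ge0.
rewrite /fubini_F/=; under eq_integral.
  move=> x _; rewrite ge0_integralZl//; last exact: mg.
  rewrite IH; over.
rewrite ge0_integralZr//; first by rewrite integral_gauss1// exprS EFinM.
apply/measurable_EFinP.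
exact: (measurableT_comp m1 (exprn_measurable 2)).
Qed.

End gaussian.

(** * The jump kernel *)

Section levy_measure.
Context {R : realType} (m : {measure set (measurableTypeR R) -> \bar R}).
Hypothesis m_levy : (\int[m]_(y in `]0%R, +oo[) (Num.min y 1)%:E < +oo)%E.

Local Notation pos := (`]0%R, +oo[%classic : set (measurableTypeR R)).

Let mpos : measurable pos. Proof. exact: measurable_itv. Qed.

Let mmin : measurable_fun pos (fun y : measurableTypeR R => (Num.min y 1)%:E).
Proof.
apply/measurable_EFinP; apply: measurable_funTS; exact: measurable_minr.
Qed.

(** The Levy condition and Markov's inequality bound the mass of [[1 / (k + 1), +oo[]; the
    nonpositive half-line is null for the restriction and can be added freely to cover the whole
    line. *)
Let sigma_finite_restr : sigma_finite setT (mrestr m mpos).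
Proof.
exists (fun k => `]-oo, 0%R] `|` `[k.+1%:R^-1, +oo[)%classic.
  apply/esym/seteqP; split => // x _.
  have [x0|x0] := leP x 0; first by exists 0%N => //; left; rewrite /= in_itv.
  exists (Num.truncn x^-1) => //; right; rewrite /= in_itv/= andbT.
  rewrite -[leRHS]invrK lef_pV2 ?posrE ?invr_gt0//.
  by apply/ltW; exact: truncnS_gt.
move=> k; have k0 : 0 < k.+1%:R^-1 :> R by rewrite invr_gt0.
split; first by apply: measurableU; exact: measurable_itv.
have := le_integral_abse m mpos mmin k0.
have -> : (\int[m]_(y in pos) `|(Num.min y 1)%:E| =
    \int[m]_(y in pos) (Num.min y 1)%:E)%E.
  apply: eq_integral => y; rewrite inE/= in_itv/= andbT => y0.
  by rewrite ger0_norm// le_min ltW/=.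
move=> /le_lt_trans/(_ m_levy); rewrite -lte_pdivlMl// => h.
apply: (le_lt_trans _ (lt_le_trans h (leey _))).
apply: le_measure; rewrite ?inE//.
- by apply: measurableI => //; apply: measurableU; exact: measurable_itv.
- apply: (emeasurable_fun_c_infty mpos).
  exact: (measurableT_comp (@abse_measurable R setT) mmin).
- move=> y /= [[|]]; rewrite !in_itv/= !andbT => h1 h2.
    by move: (le_lt_trans h1 h2); rewrite ltxx.
  split => //; rewrite lee_fin ger0_norm ?le_min ?(ltW h2)//= h1/=.
  by rewrite invf_le1// ler1n.
Qed.

(* A fresh constant: the instances on [mrestr] itself require a finite measure. *)
Definition levy_restr : set (measurableTypeR R) -> \bar R := mrestr m mpos.

HB.instance Definition _ := Measure.on levy_restr.

HB.instance Definition _ := Measure_isSigmaFinite.Build _ _ _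
  levy_restr sigma_finite_restr.

(** Sigma-finiteness of [m] is known on [pos] only, so the integrand is extended by zero and
    integrated against [levy_restr]. *)
Lemma levy_tonelli d (T : measurableType d)
    (mu : {sigma_finite_measure set T -> \bar R})
    (f : measurableTypeR R * T -> \bar R) :
  measurable_fun (pos `*` setT) f -> (forall p, (0 <= f p)%E) ->
  [/\ measurable_fun setT (fun z => \int[m]_(t in pos) f (t, z))%E,
      measurable_fun pos (fun t => \int[mu]_z f (t, z))%E &
      (\int[mu]_z \int[m]_(t in pos) f (t, z) =
       \int[m]_(t in pos) \int[mu]_z f (t, z))%E].
Proof.
move=> mf f0.
have mposT : measurable (pos `*` [set: T]) by exact: measurableX.
have mg : measurable_fun setT (f \_ (pos `*` setT)).
  exact: (measurable_restrictT f mposT).1 mf.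
have g0 p : (0 <= (f \_ (pos `*` setT)) p)%E by rewrite patchE; case: ifP.
have restrE (h : measurableTypeR R -> \bar R) :
    (\int[m]_(t in pos) h t = \int[levy_restr]_t (h \_ pos) t)%E.
  rewrite -integral_mkcond; apply: eq_measure_integral => A mA AD.
  by rewrite /= /levy_restr /mrestr setIidl.
have gE t z : (f \_ (pos `*` setT)) (t, z) = ((fun t => f (t, z)) \_ pos) t.
  rewrite !patchE; congr (if _ then _ else _).
  by apply/idP/idP; rewrite !inE/= => // -[].
split.
- rewrite (_ : (fun z => _) = fubini_G (levy_restr) (f \_ (pos `*` setT))).
    exact: (measurable_fun_fubini_tonelli_G _ mg g0).
  apply/funext => z; rewrite restrE /fubini_G.
  by apply: eq_integral => t _; rewrite gE.
- apply: (@eq_measurable_fun _ _ _ _ _ (fubini_F mu (f \_ (pos `*` setT)))).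
    by move=> t tpos; apply: eq_integral => z _; rewrite gE patchE tpos.
  apply: measurable_funTS.
  exact: (measurable_fun_fubini_tonelli_F _ mg g0).
transitivity (\int[mu]_z \int[levy_restr]_t (f \_ (pos `*` setT)) (t, z))%E.
  apply: eq_integral => z _; rewrite restrE.
  by apply: eq_integral => t _; rewrite gE.
rewrite -(fubini_tonelli _ mg g0) restrE.
apply: eq_integral => t _; rewrite [RHS]patchE; case: ifPn => tpos.
  by apply: eq_integral => z _; rewrite gE patchE tpos.
rewrite -[RHS](integral0 mu setT).
by apply: eq_integral => z _; rewrite gE patchE (negbTE tpos).
Qed.

End levy_measure.

(** * Mass and truncated second moment of the heat kernel *)

Section heat_kernel.
Context {R : realType} (d : nat).
Local Notation mu := (@lebesgueRV R d).

Lemma continuous_enorm : continuous (@enorm R d).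
Proof.
move=> x; apply: (@continuous_comp _ _ _ (@sqnorm R d) Num.sqrt).
  exact: continuous_sqnorm.
exact: sqrt_continuous.
Qed.

Lemma measurable_enorm : measurable_fun setT (@enorm R d : borelRV R d -> R).
Proof. exact: continuous_measurable_rV continuous_enorm. Qed.

Definition far (r : R) : set (borelRV R d) := [set z : 'rV[R]_d | r <= enorm z].

Lemma measurable_far r : measurable (far r).
Proof.
apply: closed_measurable_rV.
rewrite (_ : far r = @enorm R d @^-1` [set x | r <= x])//.
by apply: preimage_closed => [x _|]; [exact: continuous_enorm|exact: closed_ge].
Qed.

Lemma enorm_ge0 (z : 'rV[R]_d) : 0 <= enorm z.
Proof. exact: sqrtr_ge0. Qed.

(** Radial profile of the heat kernel at time [t]. Its mixture over [t] under [m] is [jump_density],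
    the jump kernel of a subordinate Brownian motion. *)
Definition heat (t r : R) : R :=
  (4 * pi * t) `^ (- (d%:R / 2)) * expR (- (r ^+ 2 / (4 * t))).

Lemma heat_ge0 t r : 0 <= heat t r.
Proof. by rewrite mulr_ge0 ?powR_ge0 ?expR_ge0. Qed.

Lemma heat_le t r1 r2 : 0 < t -> 0 <= r1 -> r1 <= r2 -> heat t r2 <= heat t r1.
Proof.
move=> t0 r10 r12; rewrite ler_wpM2l ?powR_ge0// ler_expR lerN2.
by rewrite ler_pM2r ?invr_gt0 ?mulr_gt0// ler_sqr ?nnegrE// (le_trans r10).
Qed.

Lemma powR_gauss (t : R) : 0 < t ->
  (4 * pi * t) `^ (- (d%:R / 2)) * Num.sqrt (pi * (4 * t)) ^+ d = 1.
Proof.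
move=> t0; have -> : pi * (4 * t) = 4 * pi * t :> R by ring.
have p0 : 0 < 4 * pi * t :> R by rewrite !mulr_gt0 ?pi_gt0.
rewrite -(powR12_sqrt (ltW p0)) -powR_mulrn ?powR_ge0// -powRrM -powRD.
  by rewrite (mulrC 2^-1) addNr powRr0.
by rewrite (gt_eqF p0) implybT.
Qed.

Let mexp (s : R) : measurable_fun setT
  ((fun z => (expR (- (sqnorm z / s)))%:E) : borelRV R d -> \bar R).
Proof.
apply/measurable_EFinP; apply: (measurableT_comp (measurable_expR_oppdiv s)).
exact: (continuous_measurable_rV (@continuous_sqnorm R d)).
Qed.

Let mheat t : measurable_fun setT
  ((fun z => (heat t (enorm z))%:E) : borelRV R d -> \bar R).
Proof.
rewrite /heat; under eq_fun do rewrite EFinM sqr_enorm.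
by apply: emeasurable_funM => //; exact: mexp.
Qed.

Lemma integral_heat t : 0 < t -> (\int[mu]_z (heat t (enorm z))%:E = 1)%E.
Proof.
move=> t0; rewrite /heat; under eq_integral do rewrite EFinM sqr_enorm.
rewrite ge0_integralZl//; last by rewrite lee_fin powR_ge0.
by rewrite integral_gauss ?mulr_gt0// -EFinM powR_gauss.
Qed.

(* Half of the Gaussian exponent absorbs the factor [q = |z|^2]:
   [q exp(- q / 4t) <= 8t exp(- q / 8t)], because [x exp(- x) <= 1]. *)
Lemma integral_heat_trunc t : 0 < t ->
  (\int[mu]_z (Num.min (enorm z ^+ 2) 1 * heat t (enorm z))%:E <=
   ((8 * Num.sqrt 2 ^+ d + 1) * Num.min t 1)%:E)%E.
Proof.
move=> t0.
have mq : measurable_fun setT ((fun z => Num.min (enorm z ^+ 2) 1) : borelRV R d -> R).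
  apply: measurable_minr => //.
  exact: (measurableT_comp (exprn_measurable 2) measurable_enorm).
have mint : measurable_fun setT
    ((fun z => (Num.min (enorm z ^+ 2) 1 * heat t (enorm z))%:E) : borelRV R d -> \bar R).
  by under eq_fun do rewrite EFinM; apply: emeasurable_funM => //; exact/measurable_EFinP.
have min0 (z : 'rV[R]_d) : 0 <= Num.min (enorm z ^+ 2) 1.
  by rewrite le_min sqr_ge0/=.
have int0 (z : 'rV[R]_d) : 0 <= Num.min (enorm z ^+ 2) 1 * heat t (enorm z).
  by rewrite mulr_ge0 ?heat_ge0.
have le1 : (\int[mu]_z (Num.min (enorm z ^+ 2) 1 * heat t (enorm z))%:E <= 1)%E.
  rewrite -(integral_heat t0); apply: ge0_le_integral => //.
  - by move=> z _; rewrite lee_fin.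
  - by move=> z _; rewrite lee_fin ler_piMl ?heat_ge0// ge_min lexx orbT.
have C0 : 0 <= 8 * Num.sqrt 2 ^+ d :> R by rewrite mulr_ge0 ?exprn_ge0 ?sqrtr_ge0.
have let' : (\int[mu]_z (Num.min (enorm z ^+ 2) 1 * heat t (enorm z))%:E <=
    (8 * Num.sqrt 2 ^+ d * t)%:E)%E.
  have -> : (8 * Num.sqrt 2 ^+ d * t)%:E =
      (\int[mu]_z ((8 * t * (4 * pi * t) `^ (- (d%:R / 2)))%:E *
        (expR (- (sqnorm z / (8 * t))))%:E))%E.
    rewrite ge0_integralZl//; last first.
      by rewrite lee_fin mulr_ge0 ?powR_ge0 ?mulr_ge0 ?ltW.
    rewrite integral_gauss ?mulr_gt0// -EFinM; congr EFin.
    (* The Gaussian is integrated at [8 t] but normalised for [4 t]: the quotient is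
       [sqrt 2 ^ d]. *)
    have -> : pi * (8 * t) = 2 * (pi * (4 * t)) :> R by ring.
    rewrite sqrtrM// exprMn.
    move: (powR_gauss t0).
    move: (_ `^ _) (Num.sqrt 2 ^+ d) (Num.sqrt (pi * _) ^+ d) => P Q S PS.
    by rewrite -[RHS]mulrA (mulrCA P) PS mulr1 mulrAC.
  apply: ge0_le_integral => //.
  - by move=> z _; rewrite lee_fin.
  - by apply: emeasurable_funM => //; exact: mexp.
  - move=> z _; rewrite -EFinM lee_fin /heat sqr_enorm.
    set P := _ `^ _; have P0 : 0 <= P by exact: powR_ge0.
    set q := sqnorm z; have q0 : 0 <= q by exact: sqnorm_ge0.
    pose x := q / (8 * t).
    have -> : q / (4 * t) = x + x by rewrite /x; field; rewrite gt_eqF.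
    rewrite opprD expRD -/x.
    have x0 : 0 <= x by rewrite divr_ge0// mulr_ge0// ltW.
    have e0 := expR_gt0 (- x).
    have xe : x * expR (- x) <= 1.
      rewrite expRN ler_pdivrMr ?expR_gt0// mul1r.
      by apply: le_trans (expR_ge1Dx x); rewrite lerDr.
    apply: (@le_trans _ _ (q * (P * (expR (- x) * expR (- x))))).
      by rewrite ler_wpM2r ?mulr_ge0 ?expR_ge0// ge_min lexx.
    have -> : q = 8 * t * x by rewrite /x mulrC divfK// gt_eqF// mulr_gt0.
    have -> : 8 * t * x * (P * (expR (- x) * expR (- x))) =
      (8 * t * P * expR (- x)) * (x * expR (- x)) by ring.
    apply: ler_piMr => //; apply: mulr_ge0; last exact: ltW.
    by apply: mulr_ge0 => //; apply: mulr_ge0 => //; exact: ltW.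
(* The summand [8 * sqrt 2 ^ d] of the constant serves small times, the summand [1] large ones. *)
have [t1|t1] := leP t 1.
  by apply: (le_trans let'); rewrite lee_fin ler_pM2r// lerDl.
by apply: (le_trans le1); rewrite lee_fin mulr1 lerDr.
Qed.

End heat_kernel.

Section jump_kernel.
Context {R : realType} (d : nat) (m : {measure set (measurableTypeR R) -> \bar R}).
Hypothesis m_levy : (\int[m]_(y in `]0%R, +oo[) (Num.min y 1)%:E < +oo)%E.
Hypothesis j_gt0 : forall r : R, 0 < r -> 0 < jump_density d m r.
Local Notation mu := (@lebesgueRV R d).
Local Notation pos := (`]0%R, +oo[%classic : set (measurableTypeR R)).

(** The real density is [fine] of this integral, hence [0] wherever the integral diverges, as it may
    at [r = 0]. Tonelli and monotone convergence are run on the extended form. *)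
Definition jumpE (r : R) : \bar R := (\int[m]_(t in pos) (heat d t r)%:E)%E.

Lemma jumpE_ge0 r : (0 <= jumpE r)%E.
Proof. by apply: integral_ge0 => t _; rewrite lee_fin heat_ge0. Qed.

Lemma fine_jumpE r : jump_density d m r = fine (jumpE r).
Proof. by []. Qed.

Lemma jump_density_ge0 r : 0 <= jump_density d m r.
Proof. by rewrite fine_jumpE fine_ge0// jumpE_ge0. Qed.

(* [fine] sends an infinite integral to [0], so that [j_gt0] excludes it. *)
Lemma jump_densityE r : 0 < r -> (jump_density d m r)%:E = jumpE r.
Proof.
move=> /j_gt0; rewrite fine_jumpE; have := jumpE_ge0 r.
by case: (jumpE r) => //=; rewrite ltxx.
Qed.

(** On [pos] the inverse agrees with the power of exponent [-1], which is measurable everywhere. *)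
Lemma measurable_inv_pos : measurable_fun pos (fun t : measurableTypeR R => (4 * t)^-1).
Proof.
apply: (@eq_measurable_fun _ _ _ _ _ (fun t : measurableTypeR R => (4 * t) `^ (-1))).
  move=> t; rewrite inE/= in_itv/= andbT => t0.
  by rewrite powR_inv1// mulr_ge0// ltW.
apply: measurable_funTS; apply: (measurableT_comp (measurable_powR _)).
exact: mulrl_measurable.
Qed.

Lemma measurable_heat1 r :
  measurable_fun pos (fun t : measurableTypeR R => (heat d t r)%:E).
Proof.
apply/measurable_EFinP; apply: measurable_funM.
  apply: measurable_funTS; apply: (measurableT_comp (measurable_powR _)).
  exact: mulrl_measurable.
apply: measurableT_comp; first exact: measurable_expR.
apply: measurable_funN; apply: measurable_funM => //.
exact: measurable_inv_pos.
Qed.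

Lemma measurable_heat : measurable_fun (pos `*` setT)
  (fun p : measurableTypeR R * borelRV R d => (heat d p.1 (enorm p.2))%:E).
Proof.
have mp : measurable pos by exact: measurable_itv.
have mpT : measurable (pos `*` [set: borelRV R d]) by exact: measurableX.
apply/measurable_EFinP; apply: measurable_funM.
  apply: measurable_funTS; apply: (measurableT_comp (measurable_powR _)).
  by apply: measurable_funM => //; exact: measurable_fst.
apply: measurableT_comp; first exact: measurable_expR.
apply: measurable_funN; apply: measurable_funM.
  apply: measurable_funTS; apply: (measurableT_comp (exprn_measurable 2)).
  exact: (measurableT_comp (@measurable_enorm R d) measurable_snd).
have sub : fst @` (pos `*` [set: borelRV R d]) `<=` pos by move=> _ [p [pp _] <-].
exact: (measurable_comp mp sub measurable_inv_pos (measurable_funTS measurable_fst)).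
Qed.

Lemma heat_tonelli :
  measurable_fun setT ((fun z => jumpE (enorm z)) : borelRV R d -> \bar R) /\
  (\int[mu]_z jumpE (enorm z) =
   \int[m]_(t in pos) \int[mu]_z (heat d t (enorm z))%:E)%E.
Proof.
by case: (levy_tonelli m_levy mu measurable_heat) => // p; rewrite lee_fin heat_ge0.
Qed.

Lemma measurable_jump : measurable_fun setT
  ((fun z => jump_density d m (enorm z)) : borelRV R d -> R).
Proof.
apply: (@measurableT_comp _ _ _ _ _ _ fine); last exact: heat_tonelli.1.
exact: fine_measurable.
Qed.

Lemma jump_density_le r1 r2 : 0 < r1 -> r1 <= r2 ->
  jump_density d m r2 <= jump_density d m r1.
Proof.
move=> r10 r12; have r20 := lt_le_trans r10 r12.
rewrite -lee_fin !jump_densityE//.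
have mh := measurable_heat1.
apply: ge0_le_integral => //.
- by move=> t _; rewrite lee_fin heat_ge0.
- move=> t /=; rewrite in_itv/= andbT => t0.
  by rewrite lee_fin heat_le// ltW.
Qed.

Definition trunc_sq (z : 'rV[R]_d) : R := Num.min (enorm z ^+ 2) 1.

Lemma trunc_sq_ge0 z : 0 <= trunc_sq z.
Proof. by rewrite le_min sqr_ge0/=. Qed.

Lemma measurable_trunc_sq : measurable_fun setT (trunc_sq : borelRV R d -> R).
Proof.
apply: measurable_minr => //.
exact: (measurableT_comp (exprn_measurable 2) (@measurable_enorm R d)).
Qed.

(** After exchanging the integrals, [integral_heat_trunc] bounds the inner one by a multiple of
    [min t 1], the very weight of the Levy condition on [m]. *)
Lemma integrable_trunc_jump : mu.-integrable setT
  (EFin \o (fun z => trunc_sq z * jump_density d m (enorm z))).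
Proof.
have mt := measurable_trunc_sq.
apply/integrableP; split.
  by apply/measurable_EFinP; apply: measurable_funM => //; exact: measurable_jump.
apply: (@le_lt_trans _ _ (\int[mu]_z ((trunc_sq z)%:E * jumpE (enorm z)))%E).
  apply: ge0_le_integral => //.
  - apply: measurableT_comp => //; apply/measurable_EFinP.
    by apply: measurable_funM => //; exact: measurable_jump.
  - apply: emeasurable_funM; [exact/measurable_EFinP|exact: heat_tonelli.1].
  - move=> z _ /=; rewrite ger0_norm ?mulr_ge0 ?trunc_sq_ge0 ?jump_density_ge0//.
    have := enorm_ge0 z; rewrite le_eqVlt => /predU1P[z0|z0].
      (* At the origin, where the density may be a default value, the weight vanishes. *)
      by rewrite /trunc_sq -z0 expr0n/= min_l// mul0r mul0e.
    by rewrite -jump_densityE// EFinM.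
have mp : measurable pos by exact: measurable_itv.
have [_ mf e] : [/\ measurable_fun setT
      ((fun z => \int[m]_(t in pos) (trunc_sq z * heat d t (enorm z))%:E)%E
        : borelRV R d -> \bar R),
    measurable_fun pos (fun t : measurableTypeR R =>
      \int[mu]_z (trunc_sq z * heat d t (enorm z))%:E)%E &
    (\int[mu]_z \int[m]_(t in pos) (trunc_sq z * heat d t (enorm z))%:E =
     \int[m]_(t in pos) \int[mu]_z (trunc_sq z * heat d t (enorm z))%:E)%E].
  apply: (@levy_tonelli _ _ m_levy _ _ mu (fun p : measurableTypeR R * borelRV R d =>
      (trunc_sq p.2 * heat d p.1 (enorm p.2))%:E)).
    apply/measurable_EFinP; apply: measurable_funM.
      by apply: measurable_funTS; exact: (measurableT_comp mt measurable_snd).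
    by apply/measurable_EFinP; exact: measurable_heat.
  by move=> p; rewrite lee_fin mulr_ge0 ?heat_ge0 ?trunc_sq_ge0.
have -> : (\int[mu]_z ((trunc_sq z)%:E * jumpE (enorm z)) =
    \int[m]_(t in pos) \int[mu]_z (trunc_sq z * heat d t (enorm z))%:E)%E.
  rewrite -e; apply: eq_integral => z _; rewrite /jumpE -ge0_integralZl//.
  - exact: measurable_heat1.
  - by move=> t _; rewrite lee_fin heat_ge0.
  - by rewrite lee_fin trunc_sq_ge0.
pose C : R := 8 * Num.sqrt 2 ^+ d + 1.
have C0 : 0 <= C by rewrite addr_ge0// mulr_ge0// exprn_ge0// sqrtr_ge0.
have mm : measurable_fun pos (fun t : measurableTypeR R => (Num.min t 1)%:E).
  by apply/measurable_EFinP; apply: measurable_funTS; exact: measurable_minr.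
apply: (@le_lt_trans _ _ (\int[m]_(t in pos) (C%:E * (Num.min t 1)%:E))%E).
  apply: ge0_le_integral => //.
  - move=> t _; apply: integral_ge0 => z _.
    by rewrite lee_fin mulr_ge0 ?heat_ge0 ?trunc_sq_ge0.
  - exact: emeasurable_funM.
  - by move=> t /=; rewrite in_itv/= andbT => t0; exact: integral_heat_trunc.
rewrite ge0_integralZl//; first by rewrite lte_mul_pinfty// ge0_fin_numE.
by move=> t /=; rewrite in_itv/= andbT => t0; rewrite lee_fin le_min ltW/=.
Qed.

(** Each heat kernel has mass 1, so the jump kernel inherits the total mass of [m], finite or
    not. *)
Lemma integral_jumpE :
  (\int[mu]_z jumpE (enorm z) = m pos)%E.
Proof.
rewrite heat_tonelli.2.
rewrite (eq_integral (fun=> 1%E)) ?integral_cst ?mul1e//.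
by move=> t; rewrite inE/= in_itv/= andbT => t0; exact: integral_heat.
Qed.

(** The point is a degenerate box. In dimension 0 it carries unit mass, and the empty product
    agrees. *)
Lemma lebesgueRV_set1 : (0 < d)%N -> mu [set (0 : 'rV[R]_d)] = 0.
Proof.
move=> d0; have := @lebesgueRV_box R d 0 0 (fun i => lexx _).
rewrite (_ : [set x | _] = [set 0]).
  move=> ->; rewrite (bigD1 (Ordinal d0))//= !mxE subrr mul0r//.
apply/seteqP; split => x /=.
  move=> h; apply/rowP => i; have := h i; rewrite in_itv/= !mxE => /andP[a b].
  by apply/eqP; rewrite eq_le b a.
by move=> -> i; rewrite in_itv/= lexx.
Qed.

Lemma enorm_eq0 (z : 'rV[R]_d) : enorm z = 0 -> z = 0.
Proof.
move=> z0; have : sqnorm z = 0 by rewrite -sqr_enorm z0 expr0n.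
move=> /eqP; rewrite psumr_eq0; last by move=> i _; rewrite sqr_ge0.
move=> /allP h; apply/rowP => i; rewrite mxE; apply/eqP.
by have := h i; rewrite mem_index_enum sqrf_eq0 => /(_ isT).
Qed.

Lemma enorm0 : enorm (0 : 'rV[R]_d) = 0.
Proof. by rewrite /enorm big1 ?sqrtr0// => i _; rewrite mxE expr0n. Qed.

(** The sets [far (1 / (k + 1))] increase to the complement of the origin, a null point, so monotone
    convergence carries the infinite total mass over to them. *)
Lemma jump_mass_unbounded (L : R) : (0 < d)%N -> m pos = +oo%E ->
  exists r : R, 0 < r <= 1 /\
    (L%:E <= \int[mu]_(z in far r) (jump_density d m (enorm z))%:E)%E.
Proof.
move=> d0 moo.
pose F (k : nat) : set (borelRV R d) := far k.+1%:R^-1.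
have mF k : measurable (F k) by exact: measurable_far.
have mJ : measurable_fun setT ((fun z => jumpE (enorm z)) : borelRV R d -> \bar R).
  exact: heat_tonelli.1.
have UF : \bigcup_k F k = setT `\` [set (0 : 'rV[R]_d)].
  apply/seteqP; split => z /=.
    move=> [k _ /=]; rewrite /F/far/= => kz; split => // z0; move: kz.
    by rewrite z0 enorm0 leNgt invr_gt0 ltr0n.
  move=> [_ z0]; have ez : 0 < enorm z.
    by rewrite lt_neqAle enorm_ge0 andbT eq_sym; apply/eqP => /enorm_eq0.
  exists (Num.truncn (enorm z)^-1) => //; rewrite /F/far/=.
  rewrite -[leRHS]invrK lef_pV2 ?posrE ?invr_gt0//.
  by apply/ltW; exact: truncnS_gt.
have cvgF := @ge0_nondecreasing_set_cvg_integral _ _ _ F (fun z => jumpE (enorm z)) mu.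
have {}cvgF : (\int[mu]_(x in F i) jumpE (enorm x))%E @[i --> \oo] --> +oo%E.
  have -> : +oo%E = (\int[mu]_(x in \bigcup_i F i) jumpE (enorm x))%E.
    rewrite UF -ge0_negligible_integral//.
    - by rewrite integral_jumpE moo.
    - apply: closed_measurable_rV; apply: accessible_closed_set1.
      exact: hausdorff_accessible (@norm_hausdorff _ _).
    - by move=> z _; exact: jumpE_ge0.
    - exact: lebesgueRV_set1.
  apply: cvgF => //.
  - move=> i j ij; apply/subsetPset => z; rewrite /F/far/=; apply: le_trans.
    by rewrite lef_pV2 ?posrE// ler_nat.
  - by move=> i; exact: measurable_funTS.
  - by move=> i x _; exact: jumpE_ge0.
have /cvgeyPge/(_ L)[N _ /(_ N (leqnn N)) h] := cvgF.
exists N.+1%:R^-1; split; first by rewrite invr_gt0 ltr0n/= invf_le1// ler1n.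
apply: (le_trans h); rewrite le_eqVlt; apply/orP; left; apply/eqP.
apply: eq_integral => z; rewrite inE /F/far/= => hz; rewrite jump_densityE//.
by apply: lt_le_trans hz; rewrite invr_gt0.
Qed.

Lemma levy_mass_neq0 : (m pos != 0)%E.
Proof.
apply/negP => /eqP m0; have := j_gt0 ltr01.
rewrite fine_jumpE /jumpE null_set_integral ?ltxx//; exact: measurable_heat1.
Qed.

End jump_kernel.

(** * Infinite Levy mass from weak scaling *)

Section infinite_mass.
Context {R : realType} (m : {measure set (measurableTypeR R) -> \bar R}).
Variables (Psi : R -> R).
Hypothesis Psi_m : zero_drift Psi m.
Hypothesis Psi_wlsc : WLSC Psi.
Local Notation pos := (`]0%R, +oo[%classic : set (measurableTypeR R)).

Let mpos : measurable pos. Proof. exact: measurable_itv. Qed.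

Let mexp x : measurable_fun pos
  (fun y : measurableTypeR R => (1 - expR (- (y * x)))%:E).
Proof.
apply/measurable_EFinP; apply: measurable_funTS; apply: measurable_funB => //.
apply: measurableT_comp; first exact: measurable_expR.
by apply: measurable_funN; exact: measurable_funM.
Qed.

Let exp_ge0 x y : 0 < x -> pos y -> 0 < 1 - expR (- (y * x)).
Proof.
rewrite /= in_itv/= andbT => x0 y0; rewrite subr_gt0 expR_lt1 oppr_lt0.
exact: mulr_gt0.
Qed.

Lemma Psi_le_mass x : 0 < x -> ((Psi x)%:E <= m pos)%E.
Proof.
move=> x0; rewrite Psi_m.2// -[leRHS]mul1e -integral_cst//.
apply: ge0_le_integral => //.
- by move=> y yp; rewrite lee_fin ltW// exp_ge0.
- by move=> y yp; rewrite lee_fin gerBl expR_ge0.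
Qed.

Lemma Psi_eq0_mass x : 0 < x -> Psi x = 0 -> m pos = 0%E.
Proof.
move=> x0 Px0; have := Psi_m.2 x x0; rewrite Px0 => /esym h.
have : (\int[m]_(y in pos) `|(1 - expR (- (y * x)))%:E| = 0)%E.
  apply: etrans h; apply: eq_integral => y; rewrite inE => yp.
  by rewrite abse_EFin ger0_norm// ltW// exp_ge0.
move=> /(ae_eq_integral_abs m mpos (mexp x)).1 [N [mN N0 sN]].
apply: (subset_measure0 mpos mN _ N0) => y yp; apply: sN => /= /(_ yp)[] /eqP.
by rewrite gt_eqF// exp_ge0.
Qed.

(** [Psi] integrates a function below 1, so its values are at most the mass of [pos]; WLSC makes it
    unbounded once it is positive somewhere beyond the threshold. It is positive there because
    [1 - exp(- y x) > 0] on [pos], which is not null. *)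
Lemma infinite_mass : (m pos != 0)%E -> m pos = +oo%E.
Proof.
move=> mn0; have [mu [c [th [mu0 /andP[c0 c1] th0 h]]]] := Psi_wlsc.
pose x0 := th + 1; have x00 : 0 < x0 by rewrite ltr_wpDl.
have P0 : 0 < Psi x0.
  rewrite lt_neqAle eq_sym; apply/andP; split.
    by apply: contra mn0 => /eqP/(Psi_eq0_mass x00)/eqP.
  rewrite -lee_fin Psi_m.2//; apply: integral_ge0 => y yp.
  by rewrite lee_fin ltW// exp_ge0.
apply/eqyP => A A0; pose B := A / (c * Psi x0).
have B0 : 0 < B by rewrite divr_gt0// mulr_gt0.
(* The root of [B] is the scaling at which WLSC yields the value [A]; the maximum with [1] keeps the
   scaling admissible. *)
pose g := Num.max 1 (B `^ mu^-1).
have g1 : 1 <= g by rewrite le_max lexx.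
apply: (@le_trans _ _ (Psi (g * x0))%:E); last first.
  by apply: Psi_le_mass; rewrite mulr_gt0// (lt_le_trans _ g1).
rewrite lee_fin; apply: le_trans (h _ _ _ g1); last by rewrite ltrDl.
have -> : A = c * B * Psi x0 by rewrite /B; field; rewrite !gt_eqF.
rewrite ler_pM2r// ler_pM2l//.
have -> : B = (B `^ mu^-1) `^ mu.
  by rewrite -powRrM mulVf ?gt_eqF// powRr1// ltW.
apply: ge0_ler_powR; rewrite ?nnegrE ?powR_ge0 ?(ltW mu0)//.
  by rewrite (le_trans _ g1).
by rewrite le_max lexx orbT.
Qed.

End infinite_mass.

(** * Thin neighbourhoods of the boundary *)

Lemma bounded_on {R : realType} {V : normedModType R} {T : Type} (f : T -> V)
    (A : set T) :
  [bounded f x | x in A] -> exists B, forall x, A x -> `|f x| <= B.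
Proof.
move=> [B [_ hB]]; exists (`|B| + 1) => x Ax; apply: (hB (`|B| + 1)) => //.
by rewrite (le_lt_trans (ler_norm _))// ltrDl.
Qed.

Lemma compact_norm_le {R : realType} {n : nat} (B : R) :
  compact [set x : 'rV[R]_n | `|x| <= B].
Proof.
apply: bounded_closed_compact.
  by exists B; split; [exact: num_real|move=> N BN x /= xB; exact: le_trans (ltW BN)].
rewrite (_ : mkset _ = (fun x : 'rV[R]_n => `|x|) @^-1` [set x | x <= B])//.
by apply: preimage_closed => [x _|]; [exact: norm_continuous|exact: closed_le].
Qed.

Section narrow.
Context {R : realType} (d : nat).
Local Notation mu := (@lebesgueRV R d).

Lemma norm_coord (x : 'rV[R]_d) i : `|x ord0 i| <= `|x|.
Proof.
rewrite leNgt; apply/negP => h.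
have : ball (0 : 'rV[R]_d) `|x ord0 i| x by rewrite -ball_normE/= sub0r normrN.
by move=> [_ /(_ ord0 i)]; rewrite /ball/= mxE sub0r normrN ltxx.
Qed.

Lemma bounded_finite_measure (D : set 'rV[R]_d) : open D -> bounded_set D ->
  (mu D < +oo)%E.
Proof.
move=> oD /bounded_on[M h].
pose a : 'rV[R]_d := const_mx (- `|M|).
pose b : 'rV[R]_d := const_mx `|M|.
have ab i : a ord0 i <= b ord0 i by rewrite !mxE ge0_cp.
apply: (@le_lt_trans _ _
  (mu [set x : 'rV[R]_d | forall i, x ord0 i \in `[a ord0 i, b ord0 i]])).
  apply: le_measure; rewrite ?inE.
  - exact: open_measurable_rV.
  - by apply: closed_measurable_rV; exact: closed_box.
  - move=> x Dx i; rewrite in_itv/= !mxE -ler_norml.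
    apply: le_trans (norm_coord _ _) _.
    exact: le_trans (h _ Dx) (ler_norm _).
by rewrite lebesgueRV_box// ltry.
Qed.

Lemma compact_exhaustion (D : set 'rV[R]_d) (e : R) :
  open D -> bounded_set D -> 0 < e ->
  exists K : set 'rV[R]_d,
    [/\ compact K, K `<=` D & (mu (D `\` K) <= e%:E)%E].
Proof.
move=> oD bD e0.
(* The points at distance at least [1 / (k + 1)] from the complement of [D]: a closed set, as what
   it omits is a union of open balls. Openness of [D] makes these sets exhaust it. *)
pose K (k : nat) : set 'rV[R]_d := [set x | ball x k.+1%:R^-1 `<=` D].
have k0 k : 0 < k.+1%:R^-1 :> R by rewrite invr_gt0.
have KD k : K k `<=` D by move=> x; apply; exact: ballxx.
have cK k : closed (K k).
  rewrite -(setCK (K k)); apply: open_closedC.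
  rewrite (_ : ~` K k = \bigcup_(y in ~` D) ball y k.+1%:R^-1).
    by apply: bigcup_open => y _; exact: ball_open.
  apply/seteqP; split => x /=.
    by move=> /existsNP[y /not_implyP[xy nDy]]; exists y => //; exact: ball_sym.
  by move=> [y nDy xy] /(_ y)/= h; apply/nDy/h/ball_sym.
have mK k : measurable (D `\` K k : set (borelRV R d)).
  by apply: measurableD; [exact: open_measurable_rV|exact: closed_measurable_rV].
have cap0 : \bigcap_k (D `\` K k) = set0.
  rewrite -subset0 => x h; have Dx : D x by have [] := h 0%N I.
  have /nbhs_ballP[r /= r0 rD] : nbhs x D by exact: open_nbhs_nbhs.
  have [_] := h (Num.truncn r^-1) I; apply.
  apply: subset_trans rD; apply: le_ball; rewrite -[leRHS]invrK.
  by rewrite lef_pV2 ?posrE ?invr_gt0//; apply/ltW; exact: truncnS_gt.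
have : (mu \o (fun k => D `\` K k)) @ \oo --> mu (\bigcap_k (D `\` K k)).
  apply: nonincreasing_cvg_mu => //.
  - apply: le_lt_trans (bounded_finite_measure oD bD).
    by apply: le_measure; rewrite ?inE//; exact: open_measurable_rV.
  - by rewrite cap0.
  - move=> i j ij; apply/subsetPset => x [Dx nK]; split => // Ki; apply: nK.
    apply: subset_trans Ki; apply: le_ball.
    by rewrite lef_pV2 ?posrE// ler_nat.
rewrite cap0 measure0 => /fine_cvgP[fn /cvgrPdist_le/(_ _ e0)].
case: fn => N1 _ fn [N2 _ h]; pose N := maxn N1 N2.
have := fn N (leq_maxl _ _); have := h N (leq_maxr _ _) => /=.
rewrite sub0r normrN => h1 h2; exists (K N); split => //.
  apply: bounded_closed_compact => //; case: bD => M [Mr hM].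
  by exists M; split => // y yM x /KD; exact: hM.
by rewrite -[leLHS](fineK h2) lee_fin; exact: le_trans (ler_norm _) h1.
Qed.

End narrow.

Section narrow_jump.
Context {R : realType} (d : nat) (m : {measure set (measurableTypeR R) -> \bar R}).
Hypothesis m_levy : (\int[m]_(y in `]0%R, +oo[) (Num.min y 1)%:E < +oo)%E.
Hypothesis j_gt0 : forall r : R, 0 < r -> 0 < jump_density d m r.
Local Notation mu := (@lebesgueRV R d).
Local Notation J z := (jump_density d m (enorm z)).

(** [K] leaves a set of measure at most [1 / j(r)]. Beyond distance [r] the kernel is at most
    [j(r)], so the jumps into [D \ K] have mass at most 1, the surplus in the hypothesis. By
    translation invariance one [K] serves every [x]. *)
Lemma narrow_domain_mass (D : set 'rV[R]_d) (r L : R) :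
  open D -> bounded_set D -> 0 < r ->
  ((L + 1)%:E <= \int[mu]_(z in far r) (J z)%:E)%E ->
  exists K : set 'rV[R]_d, [/\ compact K, K `<=` D &
    forall x, let E := far r `\` [set z : 'rV[R]_d | (D `\` K) (x + z)] in
      measurable E /\ (L%:E <= \int[mu]_(z in E) (J z)%:E)%E].
Proof.
move=> oD bD r0 hL; have jr0 := j_gt0 r0.
have [|K [cK KD hK]] := @compact_exhaustion R d D (jump_density d m r)^-1 oD bD.
  by rewrite invr_gt0.
exists K; split => // x /=.
have mA : measurable (D `\` K : set (borelRV R d)).
  apply: measurableD; first exact: open_measurable_rV.
  apply: closed_measurable_rV; apply: compact_closed => //; exact: norm_hausdorff.
set A := [set z | _].
have mAx : measurable (A : set (borelRV R d)).
  have := continuous_measurable_rVrV (@continuous_shift _ _ x) measurableT mA.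
  by rewrite setTI.
have mE : measurable (far r `\` A) by apply: measurableD => //; exact: measurable_far.
split => //.
have mS : measurable (far r `&` A) by apply: measurableI => //; exact: measurable_far.
have mJ B : measurable_fun B ((fun z => (J z)%:E) : borelRV R d -> \bar R).
  by apply: measurable_funTS; apply/measurable_EFinP; exact: measurable_jump.
have J0 (z : 'rV[R]_d) : (0 <= (J z)%:E)%E by rewrite lee_fin jump_density_ge0.
have eS : far r = (far r `&` A) `|` (far r `\` A) by rewrite setUIDK.
have dS : [disjoint far r `&` A & far r `\` A].
  by apply/disj_setPS => z [[_ zA] [_ /(_ zA)]].
move: hL; rewrite eS (ge0_integral_setU mu mS mE)// EFinD addeC -eS => h.
have h1 : (\int[mu]_(z in far r `&` A) (J z)%:E <= 1%:E)%E.
  apply: (@le_trans _ _ (\int[mu]_(z in far r `&` A) (cst (jump_density d m r)%:E z))%E).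
    apply: ge0_le_integral => //.
    by move=> z [rz _]; rewrite lee_fin jump_density_le.
  rewrite integral_cst//.
  apply: (@le_trans _ _ ((jump_density d m r)%:E * ((jump_density d m r)^-1)%:E)%E).
    apply: lee_wpmul2l; first by rewrite lee_fin ltW.
    apply: le_trans hK; rewrite -(lebesgueRV_shift x mA).
    by apply: le_measure; rewrite ?inE.
  by rewrite -EFinM mulfV ?gt_eqF.
have {h} : (1%:E + L%:E <= 1%:E + \int[mu]_(z in far r `\` A) (J z)%:E)%E.
  by apply: (le_trans h); apply: leeD.
by rewrite leeD2lE.
Qed.

End narrow_jump.

(** * Test functions *)

Section near_eq.
Context {R : realType} {V W : normedModType R}.

Lemma near_eq_differentiable (f g : V -> W) (x : V) :
  (\near x, f x = g x) -> differentiable f x -> differentiable g x.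
Proof.
move=> fg df; have [Lc Lf] := (diff_locallyP x f).1 df.
have fgx : f x = g x := nbhs_singleton fg.
have fg0 : \forall h \near (0 : V), f (h + x) = g (h + x).
  by have := fg; rewrite (near_shift 0 x); apply: filterS => h /=; rewrite subr0.
have Lg : g \o shift x = cst (g x) + 'd f x +o_ 0 id.
  apply/eqaddoP => e e0; move/eqaddoP: Lf => /(_ e e0).
  apply: filterS2 fg0 => h E.
  rewrite (_ : _ h = (g \o shift x - (cst (g x) + 'd f x)) h)//.
  rewrite -[LHS]/(f (h + x) - (f x + 'd f x h)).
  by rewrite -[RHS]/(g (h + x) - (g x + 'd f x h)) E fgx.
have dg : 'd g x = 'd f x :> (V -> W) := diff_unique Lc Lg.
by apply/diff_locallyP; rewrite dg.
Qed.

Lemma near_eq_continuous (T U : topologicalType) (f g : T -> U) (x : T) :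
  (\near x, f x = g x) -> {for x, continuous f} -> {for x, continuous g}.
Proof.
move=> fg cf; rewrite /prop_for /continuous_at -(nbhs_singleton fg).
by apply: cvg_trans cf; exact: near_eq_cvg.
Qed.

End near_eq.

Lemma bounded_funP {R : realType} {T : Type} (f : T -> R) :
  bounded_fun f <-> exists M, forall x, `|f x| <= M.
Proof.
split=> [[M [Mr h]]|[M h]].
  exists (M + 1) => x; apply: (h (M + 1)) => //; rewrite ltrDl ltr01//.
by exists M; split=> [|N MN x _]; [exact: num_real|exact: le_trans (h x) (ltW MN)].
Qed.

Section test_functions.
Context {R : realType} {d : nat}.
Implicit Types (p b y z : 'rV[R]_d) (al ka r : R) (f : 'rV[R]_d -> R).

Definition quad p b al ka y : R :=
  al + \sum_i (b ord0 i * (y ord0 i - p ord0 i) + ka * (y ord0 i - p ord0 i) ^+ 2).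

Lemma quadE p b al ka y :
  quad p b al ka y = al + \sum_i b ord0 i * (y ord0 i - p ord0 i) + ka * sqnorm (y - p).
Proof.
rewrite /quad big_split/= addrA; congr +%R.
by rewrite /sqnorm big_distrr/=; apply: eq_bigr => i _; rewrite !mxE.
Qed.

Lemma sqnorm0 : sqnorm (0 : 'rV[R]_d) = 0.
Proof. by rewrite /sqnorm big1// => i _; rewrite mxE expr0n. Qed.

Lemma sqnormN z : sqnorm (- z) = sqnorm z.
Proof. by rewrite /sqnorm; apply: eq_bigr => i _; rewrite mxE sqrrN. Qed.

Lemma enormN z : enorm (- z) = enorm z.
Proof. by congr Num.sqrt; exact: sqnormN. Qed.

Lemma sqnorm_gt0 z : z != 0 -> 0 < sqnorm z.
Proof.
move=> z0; rewrite -sqr_enorm exprn_even_gt0//=.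
by apply: contra z0 => /eqP/enorm_eq0 ->.
Qed.

Lemma quad_center p b al ka : quad p b al ka p = al.
Proof.
by rewrite quadE subrr sqnorm0 mulr0 addr0 big1 ?addr0// => i _; rewrite subrr mulr0.
Qed.

(** The linear part is odd about [p] and cancels: the slope [b] leaves no trace in the operator. *)
Lemma quad_sym p b al ka z :
  quad p b al ka (p + z) + quad p b al ka (p - z) - 2 * al = 2 * ka * sqnorm z.
Proof.
rewrite !quadE.
rewrite (_ : p + z - p = z); last by rewrite addrC addKr.
rewrite (_ : p - z - p = - z); last by rewrite addrC addKr.
rewrite sqnormN (eq_bigr (fun i => b ord0 i * z ord0 i)); last first.
  by move=> i _; rewrite !mxE (addrC (p _ _)) addrK.
rewrite [X in _ + (_ + X + _)](eq_bigr (fun i => - (b ord0 i * z ord0 i))); last first.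
  by move=> i _; rewrite !mxE (addrC (p _ _)) addrK mulrN.
rewrite sumrN; ring.
Qed.

Lemma differentiable_quad p b al ka y : differentiable (quad p b al ka) y.
Proof.
have -> : quad p b al ka = cst al + \sum_(i < d)
    (b ord0 i *: (fun y : 'rV[R]_d => y ord0 i - p ord0 i) +
    ka *: (fun y : 'rV[R]_d => y ord0 i - p ord0 i) ^+ 2).
  by apply/funext => x; rewrite fctE fct_sumE.
apply: differentiableD => //; apply: differentiable_sum => i.
have dc : differentiable (fun y : 'rV[R]_d => y ord0 i - p ord0 i) y.
  by apply: differentiableB => //; exact: differentiable_coord.
by apply: differentiableD; apply: differentiableZ => //; exact: differentiableX.
Qed.

Lemma continuous_quad p b al ka : continuous (quad p b al ka).
Proof. by move=> y; apply: differentiable_continuous; exact: differentiable_quad. Qed.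

(** The family [quad] is stable under [partial], so every regularity clause of [C2b] reduces to the
    differentiability and continuity of its members. *)
Lemma partial_quad p b al ka (j : 'I_d) :
  partial j (quad p b al ka) = quad p ((2 * ka) *: delta_mx ord0 j) (b ord0 j) 0.
Proof.
apply/funext => y; rewrite /partial /derive.
have -> : quad p ((2 * ka) *: delta_mx ord0 j) (b ord0 j) 0 y =
    b ord0 j + 2 * ka * (y ord0 j - p ord0 j).
  rewrite quadE mul0r addr0 (bigD1 j)//= !mxE !eqxx mulr1 big1 ?addr0// => i ij.
  by rewrite !mxE (negbTE ij) andbF mulr0 mul0r.
apply: cvg_lim => //.
apply: (@cvg_trans _ ((b ord0 j + 2 * ka * (y ord0 j - p ord0 j) + ka * h) @[h --> 0^'])).
  apply: near_eq_cvg; near=> h; have h0 : h != 0 by near: h; exact: nbhs_dnbhs_neq.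
  rewrite /= /quad [in RHS](bigD1 j)//= [X in _ - (_ + X)](bigD1 j)//=.
  rewrite !mxE !eqxx mulr1 [X in _ *: (_ + (_ + X) - _)](eq_bigr (fun i =>
    b ord0 i * (y ord0 i - p ord0 i) + ka * (y ord0 i - p ord0 i) ^+ 2)); last first.
    by move=> i ij; rewrite !mxE (negbTE ij) andbF mulr0 add0r.
  by rewrite /GRing.scale/=; field.
have : b ord0 j + 2 * ka * (y ord0 j - p ord0 j) + ka * h @[h --> (0:R)^'] -->
    b ord0 j + 2 * ka * (y ord0 j - p ord0 j) + ka * 0.
  apply: cvgD; first exact: cvg_cst.
  apply: cvgMr; exact: cvg_within.
by rewrite mulr0 addr0.
Unshelve. all: by end_near. Qed.

(** A viscosity test needs a function on the whole space: a paraboloid near the point, and a copy of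
    the solution elsewhere. The jump across the sphere is harmless, as [C2b] asks only for
    measurability there. *)
Definition patch r p (P f : 'rV[R]_d -> R) y := if enorm (y - p) < r then P y else f y.

Lemma open_enorm_ball p r : open [set y : 'rV[R]_d | enorm (y - p) < r].
Proof.
rewrite (_ : mkset _ = (fun y : 'rV[R]_d => enorm (- p + y)) @^-1` [set x | x < r]).
  apply: open_comp; last exact: open_lt.
  move=> y _; apply: (@continuous_comp _ _ _ (fun y : 'rV[R]_d => - p + y)).
    exact: continuous_shift.
  exact: continuous_enorm.
by apply/seteqP; split => y /=; rewrite addrC.
Qed.

Lemma coord_le_enorm z i : `|z ord0 i| <= enorm z.
Proof.
rewrite -sqrtr_sqr ler_sqrt ?sumr_ge0//; last by move=> j _; exact: sqr_ge0.
by rewrite (bigD1 i)//= lerDl sumr_ge0// => j _; exact: sqr_ge0.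
Qed.

Lemma C2b_patch r p b al ka f : 0 < r -> bounded_fun f ->
  measurable_fun setT (f : borelRV R d -> R) ->
  C2b p (patch r p (quad p b al ka) f).
Proof.
move=> r0 /bounded_funP[M hM] mf.
pose U : set 'rV[R]_d := [set y | enorm (y - p) < r].
have oU : open U by exact: open_enorm_ball.
have pU y : U y -> \near y, quad p b al ka y = patch r p (quad p b al ka) f y.
  move=> Uy; apply: (@filterS _ _ _ U); last exact: open_nbhs_nbhs.
  by move=> x; rewrite /patch /U/= => ->.
have p1 i y : U y -> \near y, quad p ((2 * ka) *: delta_mx ord0 i) (b ord0 i) 0 y =
    partial i (patch r p (quad p b al ka) f) y.
  move=> Uy; apply: (@filterS _ _ _ U); last exact: open_nbhs_nbhs.
  by move=> x Ux; rewrite -(partial_quad p b al ka i); apply: near_eq_derive; exact: pU.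
have p2 i j y : U y -> \near y,
    quad p ((2 * 0) *: delta_mx ord0 j)
      (((2 * ka) *: delta_mx ord0 i : 'rV[R]_d) ord0 j) 0 y =
    partial j (partial i (patch r p (quad p b al ka) f)) y.
  move=> Uy; apply: (@filterS _ _ _ U); last exact: open_nbhs_nbhs.
  move=> x Ux; rewrite -(partial_quad _ _ (b ord0 i)).
  by apply: near_eq_derive; exact: p1.
split.
- apply/bounded_funP.
  exists (M + (`|al| + \sum_i (`|b ord0 i| * r + `|ka| * r ^+ 2))) => y.
  have B0 : 0 <= \sum_i (`|b ord0 i| * r + `|ka| * r ^+ 2).
    by apply: sumr_ge0 => i _; rewrite addr_ge0// mulr_ge0// ?sqr_ge0// ltW.
  rewrite /patch; case: ifPn => yr; last first.
    by apply: (le_trans (hM y)); rewrite lerDl addr_ge0.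
  apply: (@le_trans _ _ (`|al| + \sum_i (`|b ord0 i| * r + `|ka| * r ^+ 2))); last first.
    by rewrite lerDr (le_trans _ (hM p)).
  rewrite /quad; apply: (le_trans (ler_normD _ _)); rewrite lerD2l.
  apply: (le_trans (ler_norm_sum _ _ _)); apply: ler_sum => i _.
  have yi : `|y ord0 i - p ord0 i| <= r.
    apply: le_trans (ltW yr).
    by have := coord_le_enorm (y - p) i; rewrite !mxE.
  apply: (le_trans (ler_normD _ _)); rewrite normrM [X in _ + X]normrM normrX.
  by rewrite lerD// ler_wpM2l// ler_sqr ?nnegrE// ltW.
- apply: measurable_fun_ifT => //.
    apply: measurable_fun_ltr => //.
    apply: (measurableT_comp (@measurable_enorm R d)).
    apply: continuous_measurable_rVrV => x; rewrite /continuous_at addrC.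
    under eq_fun do rewrite addrC.
    exact: continuous_shift.
  by apply: continuous_measurable_rV; exact: continuous_quad.
- apply: (@filterS _ _ _ U); last first.
    by apply: open_nbhs_nbhs; split => //; rewrite /U/= subrr enorm0.
  move=> y Uy; split.
  + apply: near_eq_differentiable; first exact: pU.
    exact: differentiable_quad.
  + move=> i; apply: near_eq_differentiable; first exact: p1.
    exact: differentiable_quad.
  + move=> i j; apply: near_eq_continuous; first exact: p2.
    exact: continuous_quad.
Qed.

End test_functions.

(** * The operator on patched paraboloids *)

Section test_operator.
Context {R : realType} (d : nat) (m : {measure set (measurableTypeR R) -> \bar R}).
Hypothesis m_levy : (\int[m]_(y in `]0%R, +oo[) (Num.min y 1)%:E < +oo)%E.
Hypothesis j_gt0 : forall r : R, 0 < r -> 0 < jump_density d m r.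
Local Notation mu := (@lebesgueRV R d).
Local Notation J z := (jump_density d m (enorm z)).
Implicit Types (p b y z : 'rV[R]_d) (al ka r : R) (f : 'rV[R]_d -> R).

(* The symmetric second difference at [p] of a test function that is quadratic
   with second order coefficient [ka] and value [al] at [p] within distance [r]
   of [p], and equal to [f] farther away. *)
Definition second_diff ka al f r p z : R :=
  if enorm z < r then 2 * ka * sqnorm z else f (p + z) + f (p - z) - 2 * al.

Lemma mPsi_patch r p b al ka f : 0 < r ->
  mPsi_mLaplace m (patch r p (quad p b al ka) f) p =
  2^-1 * \int[mu]_z (second_diff ka al f r p z * J z).
Proof.
move=> r0; rewrite /mPsi_mLaplace; congr (_ * _).
apply: eq_Rintegral => z _; congr (_ * _); rewrite /patch /second_diff.
rewrite subrr enorm0 r0 quad_center.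
rewrite (_ : p + z - p = z); last by rewrite addrC addKr.
rewrite (_ : p - z - p = - z); last by rewrite addrC addKr.
by rewrite enormN; case: ifP => // _; rewrite quad_sym.
Qed.

Lemma trunc_sq_far r z : 0 < r <= 1 -> ~~ (enorm z < r) -> r ^+ 2 <= trunc_sq z.
Proof.
move=> /andP[r0 r1]; rewrite -leNgt => rz.
rewrite /trunc_sq le_min; apply/andP; split.
  by rewrite ler_sqr ?nnegrE ?enorm_ge0// ltW.
by rewrite expr_le1// ltW.
Qed.

Lemma trunc_sq_near r z : r <= 1 -> enorm z < r -> trunc_sq z = sqnorm z.
Proof.
move=> r1 zr; rewrite /trunc_sq sqr_enorm min_l// -sqr_enorm expr_le1 ?enorm_ge0//.
exact: le_trans (ltW zr) r1.
Qed.

Lemma integrable_second_diff r p al ka f : 0 < r <= 1 -> bounded_fun f ->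
  measurable_fun setT (f : borelRV R d -> R) ->
  mu.-integrable setT (EFin \o (fun z => second_diff ka al f r p z * J z)).
Proof.
move=> r01 /bounded_funP[M hM] mf; have /andP[r0 r1] := r01.
have M0 : 0 <= M by exact: le_trans (hM p).
(* Within radius [r <= 1] the weight [trunc_sq] is the squared norm, matched by [2 |ka|]; beyond, it
   is at least [r ^ 2], whence the division. *)
pose C := 2 * `|ka| + (M + M + 2 * `|al|) / r ^+ 2.
have C0 : 0 <= (M + M + 2 * `|al|) / r ^+ 2.
  by rewrite divr_ge0 ?sqr_ge0// addr_ge0 ?addr_ge0// mulr_ge0.
have CC0 : 0 <= C by rewrite addr_ge0// mulr_ge0.
have mJ : measurable_fun setT ((fun z => J z) : borelRV R d -> R).
  exact: measurable_jump.
have ms : measurable_fun setT (second_diff ka al f r p : borelRV R d -> R).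
  apply: measurable_fun_ifT.
  - by apply: measurable_fun_ltr => //; exact: measurable_enorm.
  - apply: measurable_funM => //; apply: continuous_measurable_rV.
    exact: continuous_sqnorm.
  - apply: measurable_funB => //; apply: measurable_funD.
      apply: (measurableT_comp mf).
      by apply: continuous_measurable_rVrV; exact: continuous_shift.
    apply: (measurableT_comp mf).
    by apply: continuous_measurable_rVrV; exact: continuous_reflect.
apply: (@le_integrable _ _ _ mu _ measurableT _
    (EFin \o (fun z => C * (trunc_sq z * J z)))).
- by apply/measurable_EFinP; exact: measurable_funM.
- move=> z _ /=; rewrite lee_fin mulrA !normrM (ger0_norm (jump_density_ge0 _ _ _)).
  rewrite ler_wpM2r ?jump_density_ge0//.
  rewrite [`|C|]ger0_norm ?CC0//.
  rewrite (ger0_norm (trunc_sq_ge0 z)) /second_diff; case: ifPn => zr.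
    rewrite (trunc_sq_near r1 zr) !normrM (ger0_norm (sqnorm_ge0 z)) ger0_norm//.
    by rewrite ler_wpM2r ?sqnorm_ge0// lerDl.
  apply: (@le_trans _ _ (M + M + 2 * `|al|)).
    apply: le_trans (ler_normB _ _) _; rewrite normrM ger0_norm// lerD2r.
    by apply: le_trans (ler_normD _ _) _; exact: lerD.
  apply: (@le_trans _ _ ((M + M + 2 * `|al|) / r ^+ 2 * trunc_sq z)).
    rewrite -mulrA; apply: ler_peMr; first by rewrite addr_ge0 ?addr_ge0 ?mulr_ge0.
    by rewrite ler_pdivlMl ?exprn_gt0// mulr1 trunc_sq_far.
  by rewrite ler_wpM2r ?trunc_sq_ge0// lerDr mulr_ge0.
- exact: (integrableZl measurableT C (integrable_trunc_jump m_levy j_gt0)).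
Qed.

Lemma Cb_shift_bounded s (u : 'rV[R]_d -> R) : Cb u ->
  bounded_fun (fun y => u y + s) /\
  measurable_fun setT ((fun y => u y + s) : borelRV R d -> R).
Proof.
move=> [cu /bounded_funP[M hM]]; split.
  apply/bounded_funP; exists (M + `|s|) => y.
  by apply: le_trans (ler_normD _ _) _; rewrite lerD2r.
by apply: measurable_funD => //; exact: continuous_measurable_rV.
Qed.

(** The paraboloid may touch [u] at many points, and only near [p]. Strict contact is restored by
    the extra curvature [1] inside radius [r] and by the shift [r ^ 2] outside; both errors fade as
    [r] tends to 0. *)
Lemma viscosity_sub_quad (D : set 'rV[R]_d) (a u : 'rV[R]_d -> R) p b ka r :
  0 < r <= 1 -> Cb u -> viscosity_sub m D a (cst 0) u -> D p ->
  (forall y, enorm (y - p) < 1 -> u y <= quad p b (u p) ka y) ->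
  0 <= 2^-1 * (\int[mu]_z
      (second_diff (ka + 1) (u p) (fun y => u y + r ^+ 2) r p z * J z))
    + a p * u p.
Proof.
move=> /andP[r0 r1] Cu hu Dp huq.
have [bu mes_u] := Cb_shift_bounded (r ^+ 2) Cu.
rewrite -(mPsi_patch p b) //; apply: hu => //.
- exact: C2b_patch.
- by rewrite /patch subrr enorm0 r0 quad_center.
- move=> y yp; rewrite /patch; case: ifPn => yr; last by rewrite ltrDl exprn_gt0.
  apply: le_lt_trans (huq y (lt_le_trans yr r1)) _.
  by rewrite !quadE ltrD2l mulrDl mul1r ltrDl sqnorm_gt0// subr_eq0.
Qed.

Lemma viscosity_super_quad (D : set 'rV[R]_d) (a u : 'rV[R]_d -> R) p b ka r :
  0 < r <= 1 -> Cb u -> viscosity_super m D a (cst 0) u -> D p ->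
  (forall y, enorm (y - p) < 1 -> quad p b (u p) ka y <= u y) ->
  2^-1 * (\int[mu]_z
      (second_diff (ka - 1) (u p) (fun y => u y - r ^+ 2) r p z * J z))
    + a p * u p <= 0.
Proof.
move=> /andP[r0 r1] Cu hu Dp huq.
have [bu mes_u] := Cb_shift_bounded (- r ^+ 2) Cu.
rewrite -(mPsi_patch p b) //; apply: hu => //.
- exact: C2b_patch.
- by rewrite /patch subrr enorm0 r0 quad_center.
- move=> y yp; rewrite /patch; case: ifPn => yr; last by rewrite ltrBlDr ltrDl exprn_gt0.
  apply: lt_le_trans (huq y (lt_le_trans yr r1)).
  by rewrite !quadE ltrD2l mulrBl mul1r ltrBlDr ltrDl sqnorm_gt0// subr_eq0.
Qed.

End test_operator.

(** * Doubling of variables *)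

Section doubling.
Context {R : realType} (d : nat) (m : {measure set (measurableTypeR R) -> \bar R}).
Hypothesis m_levy : (\int[m]_(y in `]0%R, +oo[) (Num.min y 1)%:E < +oo)%E.
Hypothesis j_gt0 : forall r : R, 0 < r -> 0 < jump_density d m r.
Local Notation mu := (@lebesgueRV R d).
Local Notation J z := (jump_density d m (enorm z)).

Let mJ : measurable_fun setT ((fun z => J z) : borelRV R d -> R).
Proof. exact: measurable_jump. Qed.

Let iJ := @integrable_trunc_jump R d m m_levy j_gt0.

(** Controls, up to constants, both errors of a patch of radius [r]: the quadratic one inside and
    the shift [r ^ 2] outside. *)
Definition trunc_at (r : R) (z : 'rV[R]_d) : R := Num.min (sqnorm z) (r ^+ 2).

Lemma trunc_at_ge0 r z : 0 <= trunc_at r z.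
Proof. by rewrite le_min sqnorm_ge0 sqr_ge0. Qed.

Lemma trunc_at_le r z : 0 <= r <= 1 -> trunc_at r z <= trunc_sq z.
Proof.
move=> /andP[r0 r1]; rewrite /trunc_at /trunc_sq sqr_enorm le_min !ge_min lexx/=.
by rewrite expr_le1// r1 orbT.
Qed.

Lemma measurable_trunc_at r : measurable_fun setT
  ((fun z => trunc_at r z * J z) : borelRV R d -> R).
Proof.
apply: measurable_funM => //; apply: measurable_minr => //.
by apply: continuous_measurable_rV; exact: continuous_sqnorm.
Qed.

Lemma integrable_trunc_at r : 0 <= r <= 1 ->
  mu.-integrable setT (EFin \o (fun z => trunc_at r z * J z)).
Proof.
move=> r01; apply: (le_integrable measurableT _ _ iJ).
  by apply/measurable_EFinP; exact: measurable_trunc_at.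
move=> z _ /=; rewrite lee_fin !ger0_norm ?mulr_ge0 ?jump_density_ge0//
  ?trunc_at_ge0 ?trunc_sq_ge0//.
by rewrite ler_wpM2r ?jump_density_ge0// trunc_at_le.
Qed.

Lemma trunc_at_small (e r0 : R) : 0 < e -> 0 < r0 <= 1 ->
  exists r, 0 < r <= r0 /\ \int[mu]_z (trunc_at r z * J z) <= e.
Proof.
move=> e0 /andP[r00 r01].
pose r (n : nat) : R := r0 / n.+1%:R.
have rn0 n : 0 < r n by rewrite divr_gt0.
have rn1 n : r n <= r0.
  by rewrite ler_pdivrMr//; apply: ler_peMr; [exact: ltW|rewrite ler1n].
have r01n n : 0 <= r n <= 1 by rewrite ltW// (le_trans (rn1 n)).
have r_cvg : (r n ^+ 2) @[n --> \oo] --> (0 : R).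
  have h : r n @[n --> \oo] --> (0 : R).
    by rewrite -[X in _ --> X](mulr0 r0); apply: cvgMr; exact: cvg_harmonic.
  by rewrite -[X in _ --> X](mulr0 (0 : R)); apply: cvgM.
have cvg0 : (\int[mu]_z (trunc_at (r n) z * J z)%:E)%E @[n --> \oo] -->
    (\int[mu]_z (cst 0 z)%:E)%E.
  apply: (@dominated_cvg _ _ _ mu _ measurableT _ _
    (EFin \o (fun z => trunc_sq z * J z))).
  - by move=> n; apply/measurable_EFinP; exact: measurable_trunc_at.
  - move=> z _; apply/fine_cvgP; split; first by near=> n.
    apply: (@squeeze_cvgr _ _ _ _ (cst 0) (fun n => r n ^+ 2 * J z)).
    + near=> n => /=; rewrite mulr_ge0 ?trunc_at_ge0 ?jump_density_ge0//=.
      by rewrite ler_wpM2r ?jump_density_ge0// ge_min lexx orbT.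
    + exact: cvg_cst.
    + by rewrite -[X in _ --> X](mul0r (J z)); exact: cvgMl.
  - by [].
  - exact: iJ.
  - move=> n z _ /=; rewrite lee_fin ger0_norm ?mulr_ge0 ?jump_density_ge0 ?trunc_at_ge0//.
    by rewrite ler_wpM2r ?jump_density_ge0// trunc_at_le.
move: cvg0; rewrite integral0 => /fine_cvgP[_].
move=> /cvgrPdist_le/(_ _ e0)[N _ /(_ N (leqnn N))] /=.
rewrite sub0r normrN => h; exists (r N); split; first by rewrite rn0 rn1.
exact: le_trans (ler_norm _) h.
Unshelve. all: by end_near. Qed.

Lemma sqnorm_expand (y p q : 'rV[R]_d) :
  sqnorm (y - q) = sqnorm (p - q) +
    \sum_i 2 * (p - q) ord0 i * (y ord0 i - p ord0 i) + sqnorm (y - p).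
Proof.
rewrite /sqnorm -!big_split/=; apply: eq_bigr => i _; rewrite !mxE; ring.
Qed.

Variables (D : set 'rV[R]_d) (c v psi : 'rV[R]_d -> R) (lam t : R).
Hypotheses (t0 : 0 < t) (v_Cb : Cb v) (psi_Cb : Cb psi).
Hypothesis v_sub : viscosity_sub m D c (cst 0) v.
Hypothesis psi_super : viscosity_super m D (fun x => c x - lam) (cst 0) psi.

(* The bounded penalty [trunc_sq (x - x0)] forces the maximisers to converge to
   [(x0, x0)] as [k] grows. *)
Definition doubled k s x0 (x y : 'rV[R]_d) : R :=
  v x - t * psi y - k * sqnorm (x - y) - s * trunc_sq (x - x0).

(* The value [g] is gained on the jumps in [E]; the other long jumps contribute at
   most the penalty, and the short ones vanish as the radius of the quadratic
   patches tends to 0. *)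
Lemma doubling_maximum k s x0 p q r0 E g L : 0 <= k -> 0 <= s ->
  D p -> D q -> enorm (p - x0) < 1 ->
  (forall x y, doubled k s x0 x y <= doubled k s x0 p q) ->
  0 < r0 <= 1 -> 0 <= g -> measurable (E : set (borelRV R d)) -> E `<=` far r0 ->
  (forall z, E z -> v (p + z) - t * psi (q + z) - (v p - t * psi q) <= s - g) ->
  (L%:E <= \int[mu]_(z in E) (J z)%:E)%E ->
  0 <= c p * v p - t * ((c q - lam) * psi q)
    + s / r0 ^+ 2 * (\int[mu]_z (trunc_sq z * J z)) - g * L / 2.
Proof.
move=> k0 s0 Dp Dq px0 pqmax r001 g0 mE Er0 hE hL.
have /andP[r00 r01] := r001.
have tpx0 : trunc_sq (p - x0) = sqnorm (p - x0).
  by rewrite (trunc_sq_near (lexx 1)).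
(* The gradient at [p] of the two penalties in [x]. The curvature [k + s] below is their
   second-order coefficient. *)
pose b : 'rV[R]_d := (2 * k) *: (p - q) + (2 * s) *: (p - x0).
have vq y : enorm (y - p) < 1 -> v y <= quad p b (v p) (k + s) y.
  move=> _; have := pqmax y q; rewrite /doubled tpx0.
  have yx0 : s * trunc_sq (y - x0) <= s * sqnorm (y - x0).
    by rewrite ler_wpM2l// /trunc_sq sqr_enorm ge_min lexx.
  rewrite (sqnorm_expand y p q); rewrite (sqnorm_expand y p x0) in yx0.
  rewrite quadE; have -> : \sum_i b ord0 i * (y ord0 i - p ord0 i) =
    k * (\sum_i 2 * (p - q) ord0 i * (y ord0 i - p ord0 i)) +
    s * (\sum_i 2 * (p - x0) ord0 i * (y ord0 i - p ord0 i)).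
    by rewrite !mulr_sumr -big_split/=; apply: eq_bigr => i _; rewrite !mxE; ring.
  move: yx0; move: (\sum_i _) (\sum_i _) => A B; nra.
(* The slope at [q] of the coupling penalty seen by [psi], divided by [- t]. *)
pose b' : 'rV[R]_d := (- (2 * k / t)) *: (q - p).
have psiq y : enorm (y - q) < 1 -> quad q b' (psi q) (- (k / t)) y <= psi y.
  move=> _; have := pqmax p y; rewrite /doubled.
  rewrite -(sqnormN (p - y)) opprB -(sqnormN (p - q)) opprB (sqnorm_expand y q p).
  rewrite quadE; have -> : \sum_i b' ord0 i * (y ord0 i - q ord0 i) =
    - (k / t) * (\sum_i 2 * (q - p) ord0 i * (y ord0 i - q ord0 i)).
    by rewrite !mulr_sumr; apply: eq_bigr => i _; rewrite !mxE; ring.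
  move: (\sum_i _) => A h; rewrite -(ler_pM2l t0).
  have -> : t * (psi q + - (k / t) * A + - (k / t) * sqnorm (y - q)) =
    t * psi q - k * A - k * sqnorm (y - q) by field; rewrite gt_eqF.
  nra.
have JT := integrable_trunc_at.
have Jge0 (z : 'rV[R]_d) : 0 <= J z by exact: jump_density_ge0.
(* Within the patches, the second difference for [v] minus [t] times that for [psi] is [C] times the
   squared norm. *)
pose C := 2 * (k + s + 1) + 2 * (k + t).
set J1 := \int[mu]_z (trunc_sq z * J z).
have iE : mu.-integrable setT (EFin \o (fun z => \1_E z * J z)).
  apply: (le_integrable measurableT _ _ (integrableZl measurableT (r0 ^- 2) iJ)).
    by apply/measurable_EFinP; apply: measurable_funM.
  move=> z _ /=; rewrite lee_fin !normrM (ger0_norm (Jge0 _)) mulrA.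
  rewrite ler_wpM2r// !ger0_norm ?invr_ge0 ?sqr_ge0 ?trunc_sq_ge0//.
  rewrite indicE; case: (boolP (z \in E)) => [/set_mem Ez|_] /=; last first.
    by rewrite mulr_ge0 ?trunc_sq_ge0// invr_ge0 sqr_ge0.
  rewrite ler_pdivlMl ?exprn_gt0// mulr1; apply: trunc_sq_far => //.
  by rewrite -leNgt; exact: Er0.
have LE : L <= \int[mu]_z (\1_E z * J z).
  rewrite -lee_fin; apply: (le_trans hL).
  rewrite integral_mkcond /Rintegral fineK; last exact: integrable_fin_num iE.
  rewrite le_eqVlt; apply/orP; left; apply/eqP; apply: eq_integral => z _.
  by rewrite patchE indicE; case: ifPn => _; rewrite ?mul1r ?mul0r.
have key r : 0 < r <= r0 -> 0 <= c p * v p - t * ((c q - lam) * psi q)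
    + 2^-1 * (C * (\int[mu]_z (trunc_at r z * J z)) + (2 * s / r0 ^+ 2) * J1 - g * L).
  move=> /andP[r_0 r_r0]; have r1 : r <= 1 by exact: le_trans r01.
  have rr1 : 0 < r <= 1 by rewrite r_0.
  have rr1' : 0 <= r <= 1 by rewrite ltW.
  have A1 := viscosity_sub_quad rr1 v_Cb v_sub Dp vq.
  have A2 := viscosity_super_quad rr1 psi_Cb psi_super Dq psiq.
  have [bv mv] := Cb_shift_bounded (r ^+ 2) v_Cb.
  have [bp mp] := Cb_shift_bounded (- r ^+ 2) psi_Cb.
  have i1 := integrable_second_diff m_levy j_gt0 p (v p) (k + s + 1) rr1 bv mv.
  have i2 := integrable_second_diff m_levy j_gt0 q (psi q) (- (k / t) - 1) rr1 bp mp.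
  set G1 := second_diff _ _ _ _ _ in A1 i1; set G2 := second_diff _ _ _ _ _ in A2 i2.
  have : \int[mu]_z (G1 z * J z) - t * \int[mu]_z (G2 z * J z) <=
      C * (\int[mu]_z (trunc_at r z * J z)) + (2 * s / r0 ^+ 2) * J1
        - g * \int[mu]_z (\1_E z * J z).
    rewrite -!RintegralZl//; last exact: JT.
    have i1' := integrableZl measurableT t i2.
    have j1 := integrableZl measurableT C (JT r rr1').
    have j2 := integrableZl measurableT (2 * s / r0 ^+ 2) iJ.
    have j3 := integrableZl measurableT g iE.
    have j12 := integrableD measurableT j1 j2.
    rewrite -RintegralB// -RintegralD// -RintegralB//.
    apply: le_Rintegral => //.
    - exact: (integrableB measurableT i1 i1').
    - exact: (integrableB measurableT j12 j3).
    move=> z _; rewrite !mulrA -mulrBl -mulrDl -mulrBl ler_wpM2r//.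
    rewrite /G1 /G2 /second_diff; case: ifPn => zr.
      have zE : \1_E z = 0 :> R.
        rewrite indicE memNset// => /Er0; rewrite /far/= => h.
        by have := lt_le_trans zr r_r0; rewrite ltNge h.
      rewrite zE mulr0 subr0 /trunc_at min_l; last first.
        by rewrite -sqr_enorm ler_sqr ?nnegrE ?enorm_ge0// ltW.
      have -> : 2 * (k + s + 1) * sqnorm z - t * (2 * (- (k / t) - 1) * sqnorm z) =
          C * sqnorm z.
        by rewrite /C; field; rewrite gt_eqF.
      by rewrite lerDl mulr_ge0 ?trunc_sq_ge0// divr_ge0 ?sqr_ge0// mulr_ge0.
    have trz : trunc_at r z = r ^+ 2.
      rewrite /trunc_at min_r// -sqr_enorm ler_sqr ?nnegrE ?enorm_ge0 ?(ltW r_0)//.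
      by rewrite leNgt.
    (* Outside the patches, the shifts contribute [2 r ^ 2] from [v] and [2 t r ^ 2] from [psi]. *)
    have Cr : 2 * (1 + t) * r ^+ 2 <= C * r ^+ 2.
      by rewrite ler_wpM2r ?sqr_ge0// /C; nra.
    (* The common jump [w] preserves [p - q], so the coupling penalty drops out. *)
    have dlt w : v (p + w) - t * psi (q + w) - (v p - t * psi q) <=
        s * (trunc_sq (p + w - x0) - trunc_sq (p - x0)).
      have := pqmax (p + w) (q + w); rewrite /doubled.
      rewrite (_ : p + w - (q + w) = p - q); last by rewrite opprD addrACA subrr addr0.
      by nra.
    (* For [|z| <= 1] this is the parallelogram law, the truncation being inactive at [p - x0]; for
       longer jumps each truncated term is at most 1. *)
    have rho : s * (trunc_sq (p + z - x0) + trunc_sq (p - z - x0) - 2 * trunc_sq (p - x0))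
        <= 2 * s * trunc_sq z.
      rewrite [leRHS](_ : _ = s * (2 * trunc_sq z)); last by rewrite [RHS]mulrCA mulrA.
      rewrite ler_wpM2l//.
      have par : sqnorm (p + z - x0) + sqnorm (p - z - x0) - 2 * sqnorm (p - x0) =
          2 * sqnorm z.
        rewrite /sqnorm !mulr_sumr -big_split/= -sumrB; apply: eq_bigr => i _.
        rewrite !mxE; ring.
      have le1 w : trunc_sq (w : 'rV[R]_d) <= 1 by rewrite ge_min lexx orbT.
      have les w : trunc_sq (w : 'rV[R]_d) <= sqnorm w.
        by rewrite /trunc_sq sqr_enorm ge_min lexx.
      have -> : trunc_sq z = Num.min (sqnorm z) 1 by rewrite /trunc_sq sqr_enorm.
      have := trunc_sq_ge0 (p - x0).
      have := le1 (p + z - x0); have := le1 (p - z - x0).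
      have := les (p + z - x0); have := les (p - z - x0).
      rewrite tpx0; case: (leP (sqnorm z) 1) => _; lra.
    have sr0 : 2 * s * trunc_sq z <= 2 * s / r0 ^+ 2 * trunc_sq z.
      rewrite ler_wpM2r ?trunc_sq_ge0//; apply: ler_peMr; first exact: mulr_ge0.
      by rewrite invf_ge1 ?exprn_gt0// expr_le1// ltW.
    have d1 := dlt z; have d2 := dlt (- z); rewrite trz indicE.
    case: (boolP (z \in E)) => [/set_mem Ez|_] /=; last by lra.
    (* On [E] the jump by [z] gains [g] up to [s], while the jump by [- z] costs at most [s]; with
       the factor [1 / 2] of the operator this gives [g * L / 2]. *)
    have d3 := hE z Ez.
    have ts : 2 * s <= 2 * s / r0 ^+ 2 * trunc_sq z.
      rewrite -mulrA; apply: ler_peMr; first exact: mulr_ge0.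
      rewrite ler_pdivlMl ?exprn_gt0// mulr1; apply: trunc_sq_far => //.
      by rewrite -leNgt; exact: Er0.
    have d4 : s * (trunc_sq (p - z - x0) - trunc_sq (p - x0)) <= s.
      rewrite ler_piMr// lerBlDr (le_trans (y := 1))//; first by rewrite ge_min lexx orbT.
      by rewrite lerDl trunc_sq_ge0.
    lra.
  move: A1 A2 LE; move: (\int[mu]_z (\1_E z * J z)) (\int[mu]_z (G1 z * J z))
    (\int[mu]_z (G2 z * J z)) (\int[mu]_z (trunc_at r z * J z)) => IE I1 I2 IT A1 A2 LE HI.
  have gL : g * L <= g * IE by rewrite ler_wpM2l.
  have tA2 : t * (2^-1 * I2 + (c q - lam) * psi q) <= 0 by rewrite pmulr_rle0.
  lra.
apply/ler_addgt0Pr => e e0.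
have C0 : 0 < C.
  by apply: addr_gt0; apply: mulr_gt0 => //; apply: ltr_wpDl => //; exact: addr_ge0.
(* [k], and with it [C], is fixed while the patch radius shrinks, so a large [k] does no harm. *)
have [|r [rr hr]] := @trunc_at_small (e / C) r0 _ r001; first by rewrite divr_gt0.
have := key r rr; have : C * (\int[mu]_z (trunc_at r z * J z)) <= e.
  by rewrite mulrC -ler_pdivlMr.
have -> : 2 * s / r0 ^+ 2 * J1 = 2 * (s / r0 ^+ 2 * J1) by rewrite !mulrA.
lra.
Qed.

End doubling.

(** * Existence and localisation of doubled maxima *)

Section localisation.
Context {R : realType} (d : nat).

Lemma near_lt_continuous (T : topologicalType) (F : T -> R) (x : T) (M : R) :
  continuous F -> F x < M -> \forall y \near x, F y < M.
Proof.
move=> cF Fx; apply: (cF x [set r | r < M]).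
by apply: open_nbhs_nbhs; split => //; exact: open_lt.
Qed.

Lemma continuous_fun_cst (T : topologicalType) (a : R) :
  continuous (fun _ : T => a).
Proof. by move=> x; exact: cvg_cst. Qed.

Lemma continuous_funB (T : topologicalType) (f g : T -> R) :
  continuous f -> continuous g -> continuous (fun x => f x - g x).
Proof. by move=> cf cg x; apply: cvgB; [exact: cf|exact: cg]. Qed.

Lemma continuous_funM (T : topologicalType) (f g : T -> R) :
  continuous f -> continuous g -> continuous (fun x => f x * g x).
Proof. by move=> cf cg x; apply: cvgM; [exact: cf|exact: cg]. Qed.

Lemma continuous_funmin (T : topologicalType) (f g : T -> R) :
  continuous f -> continuous g -> continuous (fun x => Num.min (f x) (g x)).
Proof. by move=> cf cg x; exact: (continuous_min (cf x) (cg x)). Qed.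

Lemma continuous_fun1 (f : 'rV[R]_d -> R) : continuous f ->
  continuous (fun p : 'rV[R]_d * 'rV[R]_d => f p.1).
Proof.
by move=> cf p; apply: (@continuous_comp _ _ _ fst f); [exact: cvg_fst|exact: cf].
Qed.

Lemma continuous_fun2 (f : 'rV[R]_d -> R) : continuous f ->
  continuous (fun p : 'rV[R]_d * 'rV[R]_d => f p.2).
Proof.
by move=> cf p; apply: (@continuous_comp _ _ _ snd f); [exact: cvg_snd|exact: cf].
Qed.

Lemma continuous_sqdist :
  continuous (fun p : 'rV[R]_d * 'rV[R]_d => sqnorm (p.1 - p.2)).
Proof.
move=> p; apply: (@continuous_comp _ _ _
  (fun p : 'rV[R]_d * 'rV[R]_d => p.1 - p.2) (@sqnorm R d)).
  exact: (@sub_continuous 'rV[R]_d).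
exact: continuous_sqnorm.
Qed.

Lemma continuous_trunc_sq (x0 : 'rV[R]_d) :
  continuous (fun x : 'rV[R]_d => trunc_sq (x - x0)).
Proof.
have -> : (fun x : 'rV[R]_d => trunc_sq (x - x0)) =
    (fun x => Num.min (sqnorm (- x0 + x)) 1).
  by apply/funext => x; rewrite /trunc_sq sqr_enorm addrC.
apply: continuous_funmin; last exact: continuous_fun_cst.
move=> x; apply: (@continuous_comp _ _ _ (fun x : 'rV[R]_d => - x0 + x) (@sqnorm R d)).
  exact: continuous_shift.
exact: continuous_sqnorm.
Qed.

Lemma norm_le_enorm (z : 'rV[R]_d) : `|z| <= enorm z.
Proof.
apply/ler_addgt0Pr => e e0; apply: ltW.
have e1 : 0 < enorm z + e by rewrite ltr_wpDl// enorm_ge0.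
have : ball (0 : 'rV[R]_d) (enorm z + e) z.
  split => // i j; rewrite (ord1 i) /ball/= mxE sub0r normrN.
  by apply: le_lt_trans (coord_le_enorm z j) _; rewrite ltrDl.
by rewrite -ball_normE/= sub0r normrN.
Qed.

(** Only one of the two points has to lie in the compact set: later [p + z] is in [K], whereas
    [q + z] may have left it. *)
Lemma compact_uniform_continuity (K : set 'rV[R]_d) (f : 'rV[R]_d -> R) (e : R) :
  compact K -> continuous f -> 0 < e ->
  exists2 r, 0 < r & forall x y, K x -> ball x r y -> `|f x - f y| < e.
Proof.
move=> /compact_near_coveringP cK cf e0.
have h : \forall r \near (0:R)^'+,
    K `<=` [set x | forall y, ball x r y -> `|f x - f y| < e].
  apply: cK => x _; have e2 : 0 < e / 2 by rewrite divr_gt0.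
  have /cvgrPdist_lt/(_ _ e2) := cf x; rewrite near_simpl.
  move=> /nbhs_ballP[r /= r0 hr]; have r2 : 0 < r / 2 by rewrite divr_gt0.
  exists (ball x (r / 2), [set r' | r' < r / 2]); first split => /=.
  - exact: nbhsx_ballx.
  - exact: nbhs_right_lt.
  move=> [x' r'] /= [xx' r'r] y x'y.
  have h1 : `|f x - f x'| < e / 2.
    by apply: hr; apply: le_ball xx'; rewrite ler_pdivrMr// ler_peMr ?ler1n// ltW.
  have h2 : `|f x - f y| < e / 2.
    apply: hr; rewrite [r in ball _ r _]splitr; apply: ball_triangle xx' _.
    exact: le_ball (ltW r'r) _ x'y.
  rewrite -(subrK (f x) (f x')) -addrA (le_lt_trans (ler_normD _ _))//.
  by rewrite [ltRHS]splitr ltrD// distrC.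
have /filter_ex[r [r0 hr]] : \forall r \near (0:R)^'+, 0 < r /\
    K `<=` [set x | forall y, ball x r y -> `|f x - f y| < e].
  by near=> r; split; [by []|near: r; exact: h].
by exists r => // x y Kx xy; exact: hr.
Unshelve. all: by end_near. Qed.

Variables (D K : set 'rV[R]_d) (v psi : 'rV[R]_d -> R) (t s : R) (x0 : 'rV[R]_d).
Hypotheses (D_bnd : bounded_set D) (v_Cb : Cb v) (psi_Cb : Cb psi).
Hypotheses (v_ext : forall x, ~ D x -> v x <= 0) (psi_ge0 : forall x, 0 <= psi x).
Hypotheses (t0 : 0 < t) (s0 : 0 < s) (Dx0 : D x0).
Hypothesis x0_max : forall x, v x - t * psi x <= v x0 - t * psi x0.
Hypothesis M_ge0 : 0 <= v x0 - t * psi x0.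

Lemma continuous_doubled k :
  continuous (fun p : 'rV[R]_d * 'rV[R]_d => doubled v psi t k s x0 p.1 p.2).
Proof.
have cst_cont (a : R) : continuous (fun _ : 'rV[R]_d * 'rV[R]_d => a).
  exact: continuous_fun_cst.
apply: continuous_funB; last first.
  apply: continuous_funM => //; apply: (@continuous_fun1 (fun x => trunc_sq (x - x0))).
  exact: continuous_trunc_sq.
apply: continuous_funB; last by apply: continuous_funM => //; exact: continuous_sqdist.
apply: continuous_funB; first by apply: continuous_fun1; case: v_Cb.
by apply: continuous_funM => //; apply: continuous_fun2; case: psi_Cb.
Qed.

(* A covering argument on a compact square replaces the extraction of convergent
   subsequences: off a neighbourhood of [(x0, x0)], the doubled function is
   eventually below its value at [(x0, x0)]. *)
Lemma localised_maximum (r : R) : 0 < r ->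
  exists k p q, [/\ 0 <= k, ball x0 r p, ball x0 r q &
    forall x y, doubled v psi t k s x0 x y <= doubled v psi t k s x0 p q].
Proof.
move=> r0; set M := v x0 - t * psi x0.
have dM k : doubled v psi t k s x0 x0 x0 = M.
  rewrite /doubled subrr sqnorm0 mulr0 subr0.
  by rewrite /trunc_sq enorm0 expr0n/= min_l// mulr0 subr0.
have [V hV] : exists V, forall x, `|v x| <= V by apply/bounded_funP; case: v_Cb.
have V0 : 0 <= V by exact: le_trans (hV x0).
have [B hB] := bounded_on D_bnd.
(* The margin [1] separates [D] from the complement of [C]: a pair [x] in [D], [y] off [C] is more
   than 1 apart, so a coefficient above [V] makes its doubled value nonpositive. *)
pose C : set 'rV[R]_d := [set x | `|x| <= B + 1].
have DC x : D x -> C x by move=> /hB xB; rewrite /C/= (le_trans xB)// lerDl.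
have cC : compact C by exact: compact_norm_le.
have cCC : compact (C `*` C) by exact: compact_setX.
have tpsi x : 0 <= t * psi x by rewrite mulr_ge0// ltW.
have ub k x y : doubled v psi t k s x0 x y <= V - k * sqnorm (x - y).
  have := hV x; have := ler_norm (v x); have := tpsi y.
  have : 0 <= s * trunc_sq (x - x0) by rewrite mulr_ge0 ?trunc_sq_ge0// ltW.
  rewrite /doubled; lra.
pose P (n : nat) (p : 'rV[R]_d * 'rV[R]_d) :=
  (ball x0 r p.1 /\ ball x0 r p.2) \/ doubled v psi t n%:R s x0 p.1 p.2 < M.
have /compact_near_coveringP/(_ nat \oo P) hP := cCC.
have {hP} [N _ hN] : \forall n \near \oo, C `*` C `<=` P n.
  apply: hP => -[a b] _.
  have [ab|/eqP ab] := pselect (a = b); last first.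
    (* Off the diagonal the coupling penalty eventually exceeds [V], and a negative value is below
       [M]. *)
    have e0 : 0 < sqnorm (a - b) by rewrite sqnorm_gt0// subr_eq0.
    have cn : continuous (fun p : 'rV[R]_d * 'rV[R]_d => 0 - sqnorm (p.1 - p.2)).
      apply: continuous_funB; last exact: continuous_sqdist.
      exact: continuous_fun_cst.
    have n1 : \forall p \near (a, b), 0 - sqnorm (p.1 - p.2) < - (sqnorm (a - b) / 2).
      apply: (near_lt_continuous cn).
      by rewrite /= sub0r ltrN2 ltr_pdivrMr// ltr_pMr// ltr1n.
    have n2 : \forall n \near \oo, V / (sqnorm (a - b) / 2) < n%:R.
      exact: nbhs_infty_gtr.
    exists ([set p | 0 - sqnorm (p.1 - p.2) < - (sqnorm (a - b) / 2)],
            [set n | V / (sqnorm (a - b) / 2) < n%:R]); first by split.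
    move=> [[x y] n] /= [xy nV]; right.
    have {}xy : sqnorm (a - b) / 2 < sqnorm (x - y) by lra.
    apply: le_lt_trans (ub _ _ _) _; apply: lt_le_trans M_ge0; rewrite subr_lt0.
    rewrite -ltr_pdivrMr; last by apply: lt_trans xy; rewrite divr_gt0.
    apply: le_lt_trans nV; rewrite ler_wpM2l// lef_pV2 ?posrE ?divr_gt0//.
      exact: ltW.
    by apply: lt_trans xy; rewrite divr_gt0.
  subst b; have [->|/eqP ax0] := pselect (a = x0).
    have n1 : nbhs (x0, x0) (ball x0 r `*` ball x0 r).
      by exists (ball x0 r, ball x0 r) => //; split; exact: nbhsx_ballx.
    exists (ball x0 r `*` ball x0 r, setT); first by split => //; exact: filterT.
    by move=> [[x y] n] /= [[? ?] _]; left.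
  (* On the diagonal away from [x0] the penalty in [s] is positive; [k = 0] suffices, as [doubled]
     decreases in [k]. *)
  have n1 : \forall p \near (a, a), doubled v psi t 0 s x0 p.1 p.2 < M.
    apply: (near_lt_continuous (@continuous_doubled 0)).
    rewrite /= /doubled mul0r subr0; apply: lt_le_trans (x0_max a).
    rewrite ltrBlDr ltrDl mulr_gt0//.
    rewrite /trunc_sq lt_min ltr01 andbT sqr_enorm sqnorm_gt0//.
    by rewrite subr_eq0.
  exists ([set p | doubled v psi t 0 s x0 p.1 p.2 < M], setT).
    by split => //; exact: filterT.
  move=> [[x y] n] /= [xy _]; right; apply: le_lt_trans xy.
  rewrite /doubled mul0r subr0 lerD2r gerDl oppr_le0 mulr_ge0 ?sqnorm_ge0//.
have [N' _ hN'] := nbhs_infty_gtr V.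
pose n := maxn N N'.
have Vn : V < n%:R by apply: hN'; exact: leq_maxr.
have {}hN := hN n (leq_maxl _ _).
have [||[p q] pqC hpq] := @compact_EVT_max _ R
    (fun p => doubled v psi t n%:R s x0 p.1 p.2) (C `*` C) _ cCC.
- by exists (x0, x0); split => /=; exact: DC.
- by apply: continuous_subspaceT; exact: continuous_doubled.
have Mpq : M <= doubled v psi t n%:R s x0 p q.
  by rewrite -(dM n%:R); apply: (hpq (x0, x0)); rewrite inE; split => /=; exact: DC.
exists n%:R, p, q.
have [//|[]|] := hN (p, q); [by rewrite inE in pqC| |]; last first.
  by rewrite /= ltNge Mpq.
move=> bp bq; split => // x y.
have [Dx|nDx] := pselect (D x); last first.
  apply: le_trans Mpq; apply: le_trans M_ge0.
  have := v_ext nDx; have := tpsi y.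
  have : 0 <= s * trunc_sq (x - x0) by rewrite mulr_ge0 ?trunc_sq_ge0// ltW.
  have : 0 <= n%:R * sqnorm (x - y) by rewrite mulr_ge0 ?sqnorm_ge0.
  rewrite /doubled; lra.
have [Cy|nCy] := pselect (C y).
  by apply: (hpq (x, y)); rewrite inE; split => //=; exact: DC.
apply: le_trans Mpq; apply: le_trans M_ge0; apply: (le_trans (ub _ _ _)).
rewrite subr_le0; apply: (le_trans (ltW Vn)).
rewrite ler_peMr// -sqr_enorm.
have : 1 < `|x - y|.
  have {}nCy : B + 1 < `|y| by rewrite ltNge; exact/negP.
  have := hB x Dx; have := ler_normB x (x - y).
  rewrite opprB addrC subrK; lra.
move=> /ltW h1; rewrite expr_ge1// ?enorm_ge0//; exact: le_trans (norm_le_enorm _).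
Qed.

End localisation.

(** * Comparison *)

Section contact.
Context {R : realType} (d : nat) (m : {measure set (measurableTypeR R) -> \bar R}).
Hypothesis m_levy : (\int[m]_(y in `]0%R, +oo[) (Num.min y 1)%:E < +oo)%E.
Hypothesis j_gt0 : forall r : R, 0 < r -> 0 < jump_density d m r.
Local Notation mu := (@lebesgueRV R d).
Local Notation J z := (jump_density d m (enorm z)).

Lemma near_lt_pointwise (T : topologicalType) (c1 v1 c2 p2 : T -> R) (x : T)
    (t lam e : R) :
  {for x, continuous c1} -> {for x, continuous v1} ->
  {for x, continuous c2} -> {for x, continuous p2} -> 0 < e ->
  \forall y \near x, c1 y * v1 y - t * ((c2 y - lam) * p2 y) <
    c1 x * v1 x - t * ((c2 x - lam) * p2 x) + e.
Proof.
move=> k1 k2 k3 k4 e0.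
have : c1 y * v1 y - t * ((c2 y - lam) * p2 y) @[y --> x] -->
    c1 x * v1 x - t * ((c2 x - lam) * p2 x).
  apply: cvgB; first exact: cvgM.
  by apply: cvgMr; apply: cvgM => //; apply: cvgB => //; exact: cvg_cst.
move=> h; apply: (h [set r | r < c1 x * v1 x - t * ((c2 x - lam) * p2 x) + e]).
by apply: open_nbhs_nbhs; split; [exact: open_lt|rewrite /= ltrDl].
Qed.

Lemma continuous_ratio (T : topologicalType) (f g : T -> R) (x : T) :
  {for x, continuous f} -> {for x, continuous g} -> g x != 0 ->
  {for x, continuous (fun x => f x / g x)}.
Proof. by move=> cf cg g0; apply: cvgM => //; exact: cvgV. Qed.

Variables (D K : set 'rV[R]_d) (c v psi : 'rV[R]_d -> R) (lam t Cc r0 : R).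
Hypotheses (oD : open D) (bD : bounded_set D) (cK : compact K) (r001 : 0 < r0 <= 1).
Hypotheses (c_cont : {in D, continuous c}) (c_bnd : forall x, D x -> `|c x| <= Cc).
Hypotheses (v_Cb : Cb v) (v_sub : viscosity_sub m D c (cst 0) v).
Hypotheses (psi_Cb : Cbplus D psi).
Hypothesis psi_super : viscosity_super m D (fun x => c x - lam) (cst 0) psi.
Hypotheses (v_ext : forall x, ~ D x -> v x <= 0) (t0 : 0 < t) (lam0 : lam < 0).
Hypothesis mass : forall x,
  let E := far r0 `\` [set z : 'rV[R]_d | (D `\` K) (x + z)] in
  measurable E /\ ((2 * Cc)%:E <= \int[mu]_(z in E) (J z)%:E)%E.
Hypothesis leK : forall x, K x -> v x - t * psi x <= 0.

Lemma no_nonnegative_maximum (x0 : 'rV[R]_d) : D x0 ->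
  (forall x, v x - t * psi x <= v x0 - t * psi x0) -> 0 <= v x0 - t * psi x0 -> False.
Proof.
move=> Dx0 hmax; set M := v x0 - t * psi x0 => M0.
have [psiC psi0 psiD] := psi_Cb.
have /andP[r00 r01] := r001.
have px0 : 0 < psi x0 by exact: psiD.
set J1 := \int[mu]_z (trunc_sq z * J z).
have J10 : 0 <= J1.
  by apply: Rintegral_ge0 => z _; rewrite mulr_ge0 ?trunc_sq_ge0 ?jump_density_ge0.
(* A quarter of the deficit [- lam t psi(x0)]. One quarter pays for the penalty, another for moving
   from [(x0, x0)] to [(p, q)]. *)
pose eta := - lam * (t * psi x0) / 4.
have eta0 : 0 < eta by rewrite divr_gt0// mulr_gt0 ?oppr_gt0// mulr_gt0.
have q0 : 0 <= J1 / r0 ^+ 2 by rewrite divr_ge0 ?sqr_ge0.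
have q1 : 0 < J1 / r0 ^+ 2 + 1 by rewrite ltr_wpDl.
(* The summand [1] keeps the denominator positive even if [J1] vanishes. *)
pose s := eta / (J1 / r0 ^+ 2 + 1).
have s0 : 0 < s by rewrite divr_gt0.
have sJ : s / r0 ^+ 2 * J1 <= eta.
  have -> : s / r0 ^+ 2 * J1 = s * (J1 / r0 ^+ 2) by rewrite mulrAC -mulrA.
  by rewrite /s mulrAC ler_pdivrMr// ler_wpM2l ?(ltW eta0)// lerDl.
have [dl dl0 hdl] : exists2 r, 0 < r &
    forall x y, K x -> ball x r y -> `|psi x - psi y| < s / t.
  by apply: compact_uniform_continuity => //; [case: psiC|exact: divr_gt0].
have cx0 : {for x0, continuous c} by apply: c_cont; rewrite inE.
pose X := ('rV[R]_d * 'rV[R]_d)%type.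
have n1 : \forall p \near ((x0, x0) : X), c p.1 * v p.1 - t * ((c p.2 - lam) * psi p.2) <
    c x0 * v x0 - t * ((c x0 - lam) * psi x0) + eta.
  apply: (@near_lt_pointwise X (fun p => c p.1) (fun p => v p.1) (fun p => c p.2)
    (fun p => psi p.2) (x0, x0)) => //.
  - by apply: (@continuous_comp _ _ _ fst c); [exact: cvg_fst|].
  - by apply: continuous_fun1; case: v_Cb.
  - by apply: (@continuous_comp _ _ _ snd c); [exact: cvg_snd|].
  - by apply: continuous_fun2; case: psiC.
have nD : nbhs x0 D by exact: open_nbhs_nbhs.
have n2 : nbhs ((x0, x0) : X) (D `*` D) by exists (D, D).
have n3 : \forall p \near ((x0, x0) : X), sqnorm (p.1 - x0) < 1.
  exists ([set x | sqnorm (x - x0) < 1], setT); last by move=> [x y] [].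
  split; last exact: filterT.
  have cs : continuous (fun x : 'rV[R]_d => sqnorm (- x0 + x)).
    move=> x; apply: (@continuous_comp _ _ _ (fun x : 'rV[R]_d => - x0 + x) (@sqnorm R d)).
      exact: continuous_shift.
    exact: continuous_sqnorm.
  have := near_lt_continuous cs (_ : sqnorm (- x0 + x0) < 1).
  rewrite addNr sqnorm0 => /(_ ltr01); apply: filterS => x /=.
  by rewrite addrC.
have [[A B] /= [/nbhs_ballP[a /= a0 hA] /nbhs_ballP[b /= b0 hB]] hAB] :=
  filterI n1 (filterI n2 n3).
have r0' : 0 < Num.min (Num.min a b) (dl / 2) by rewrite !lt_min a0 b0 divr_gt0.
have [k [p [q [k0 bp bq pqmax]]]] :=
  localised_maximum bD v_Cb psiC v_ext psi0 t0 s0 Dx0 hmax M0 r0'.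
have [|/= H [[/= Dp Dq] px]] := hAB (p, q).
  split; [apply: hA; apply: le_ball bp|apply: hB; apply: le_ball bq].
    by rewrite !ge_min lexx.
  by rewrite !ge_min lexx orbT.
have pq : ball p dl q.
  rewrite [dl]splitr; apply: (@ball_triangle _ _ x0).
    by apply: ball_sym; apply: le_ball bp; rewrite ge_min lexx orbT.
  by apply: le_ball bq; rewrite ge_min lexx orbT.
have Mpq : M <= v p - t * psi q.
  have := pqmax x0 x0; rewrite {1}/doubled !subrr sqnorm0 mulr0 subr0.
  rewrite {1}/trunc_sq enorm0 expr0n/= min_l// mulr0 subr0 -/M.
  have : 0 <= s * trunc_sq (p - x0) by rewrite mulr_ge0 ?trunc_sq_ge0// ltW.
  have : 0 <= k * sqnorm (p - q) by rewrite mulr_ge0 ?sqnorm_ge0.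
  rewrite /doubled; lra.
have [mE hE] := mass p.
have px1 : enorm (p - x0) < 1.
  by rewrite -[ltRHS]sqrtr1 ltr_sqrt.
(* A jump in [E] leaves [D], where [v <= 0], or lands in [K], where [leK] applies once [psi (q + z)]
   is exchanged for [psi (p + z)] at a cost of at most [s]. *)
have hE' z : (far r0 `\` [set z : 'rV[R]_d | (D `\` K) (p + z)]) z ->
    v (p + z) - t * psi (q + z) - (v p - t * psi q) <= s - M.
  move=> [_ /= nDK]; have [Dpz|nDpz] := pselect (D (p + z)); last first.
    have := v_ext nDpz; have : 0 <= t * psi (q + z) by rewrite mulr_ge0 ?psi0// ltW.
    by have := ltW s0; lra.
  have Kpz : K (p + z) by apply: contrapT => nK; exact: nDK.
  have := leK Kpz; have : `|psi (p + z) - psi (q + z)| < s / t.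
    apply: hdl => //; move: pq; rewrite -!ball_normE/=.
    by rewrite (_ : p + z - (q + z) = p - q)// opprD addrACA subrr addr0.
  rewrite ltr_pdivlMr// mulrC => h1.
  have : t * (psi (p + z) - psi (q + z)) <= t * `|psi (p + z) - psi (q + z)|.
    by rewrite ler_wpM2l ?ler_norm// ltW.
  lra.
(* With [g = M] and [L = 2 * Cc] the right-hand side is below
   [c x0 * M - 4 eta + eta + eta - Cc * M], hence below [- 2 eta]. *)
have := doubling_maximum m_levy j_gt0 t0 v_Cb psiC v_sub psi_super k0 (ltW s0) Dp Dq px1
  pqmax r001 M0 mE (@subDsetl _ _ _) hE' hE.
rewrite -/J1.
have cM : c x0 * M <= Cc * M.
  by rewrite ler_wpM2r// (le_trans (ler_norm _))// c_bnd.
have eE : c x0 * v x0 - t * ((c x0 - lam) * psi x0) = c x0 * M - 4 * eta.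
  by rewrite /M /eta; field.
rewrite eE in H.
have -> : M * (2 * Cc) / 2 = Cc * M by field.
lra.
Qed.

End contact.

Theorem theorem3p4 (R : realType) (d : nat) (d_ge2 : (2 <= d)%N)
  (D : set 'rV[R]_d) (D_dom : domain D) (D_bnd : bounded_set D)
  (D_C11 : C11_boundary D) (D0 : D 0)
  (c : 'rV[R]_d -> R) (c_bnd : [bounded c x | x in D])
  (c_cont : {within D, continuous c})
  (Psi : R -> R) (m : {measure set (measurableTypeR R) -> \bar R})
  (Psi_B0 : bernstein0 Psi) (Psi_m : zero_drift Psi m)
  (j_gt0 : forall r, 0 < r -> 0 < jump_density d m r)
  (Psi_wlsc : WLSC Psi)
  (lambda_lt0 : (principal_eigenvalue m D c < 0)%E)
  (v : 'rV[R]_d -> R) (v_Cb : Cb v)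
  (v_sub : viscosity_sub m D c (cst 0) v)
  (v_ext : forall x, ~ D x -> v x <= 0) :
  forall x, v x <= 0.
Proof.
have [oD _ _] := D_dom; have m_levy := Psi_m.1.
have d0 : (0 < d)%N by exact: leq_trans d_ge2.
have [_ [lam [psi [psiP psi_super]] <-]] := ereal_inf_lt lambda_lt0.
rewrite lte_fin => lam0; have [psiC psi0 psiD] := psiP.
have {}c_cont : {in D, continuous c} by rewrite -continuous_open_subspace.
have [Cc hCc] := bounded_on c_bnd.
have [B hB] := bounded_on D_bnd.
pose C : set 'rV[R]_d := [set x | `|x| <= B].
have moo := infinite_mass Psi_m Psi_wlsc (levy_mass_neq0 j_gt0).
(* The surplus [1] is given up to the jumps into the thin set. *)
have [r0 [r001 hr0]] := jump_mass_unbounded m_levy j_gt0 (2 * Cc + 1) d0 moo.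
have /andP[r00 _] := r001.
have [K [cK KD mass]] := narrow_domain_mass m_levy j_gt0 oD D_bnd r00 hr0.
have no_max t x0 : 0 < t -> (forall x, K x -> v x - t * psi x <= 0) -> D x0 ->
    (forall x, v x - t * psi x <= v x0 - t * psi x0) -> v x0 - t * psi x0 < 0.
  move=> t0 leK Dx0 hmax; rewrite ltNge; apply/negP.
  exact: (no_nonnegative_maximum m_levy j_gt0 oD D_bnd cK r001 c_cont hCc v_Cb v_sub
    psiP psi_super v_ext t0 lam0 mass leK Dx0 hmax).
have cw t : continuous (fun x => v x - t * psi x).
  apply: continuous_funB; first by case: v_Cb.
  by apply: continuous_funM; [exact: continuous_fun_cst|case: psiC].
have ext t x : 0 < t -> ~ D x -> v x - t * psi x <= 0.
  by move=> t0 nDx; rewrite subr_le0 (le_trans (v_ext x nDx))// mulr_ge0// ltW.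
have cC : compact C by exact: compact_norm_le.
(* A positive value makes the maximum over the ball [C] a global one located in [D], which [no_max]
   forbids. *)
have whole t : 0 < t -> (forall x, K x -> v x - t * psi x <= 0) ->
    forall x, v x - t * psi x <= 0.
  move=> t0 leK x; have [Dx|] := pselect (D x); last exact: ext.
  have [||x0 _ hx0] := @compact_EVT_max _ R (fun x => v x - t * psi x) C _ cC.
  - by exists x; exact: hB.
  - exact: continuous_subspaceT (cw t).
  have hx : v x - t * psi x <= v x0 - t * psi x0.
    by apply: hx0; rewrite inE; exact: hB.
  rewrite leNgt; apply/negP => wx; have w0 := lt_le_trans wx hx.
  have Dx0 : D x0 by apply: contrapT => /(ext t x0 t0); rewrite leNgt w0.
  suff : v x0 - t * psi x0 < 0 by rewrite ltNge (ltW w0).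
  apply: no_max => // y; have [Dy|/(ext t y t0) wy] := pselect (D y).
    by apply: hx0; rewrite inE; exact: hB.
  exact: le_trans wy (ltW w0).
have [K0|/existsNP[y /not_implyP[Ky /negP]]] := pselect (forall y, K y -> v y <= 0).
  have h t x : 0 < t -> v x - t * psi x <= 0.
    move=> t0; apply: whole => // y Ky.
    by rewrite subr_le0 (le_trans (K0 y Ky))// mulr_ge0// ltW.
  move=> x; apply/ler_addgt0Pr => e e0.
  (* This is [t] tending to 0 at a fixed [x]; the [1] is there because [psi] may vanish off [D]. *)
  have p1 : 0 < psi x + 1 by rewrite ltr_wpDl.
  have := h (e / (psi x + 1)) x (divr_gt0 e0 p1).
  rewrite subr_le0 add0r => /le_trans; apply.
  by rewrite mulrAC ler_pdivrMr// ler_wpM2l ?(ltW e0)// lerDl.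
rewrite -ltNge => vy.
have [||x0 /set_mem Kx0 hx0] := @compact_EVT_max _ R (fun x => v x / psi x) K _ cK.
- by exists y.
- apply: continuous_in_subspaceT => x /set_mem /KD /psiD px.
  apply: continuous_ratio; first by case: v_Cb => + _; apply.
    by case: psiC => + _; apply.
  by rewrite gt_eqF.
have px0 := psiD _ (KD _ Kx0).
(* The least [t] with [v <= t psi] on [K]: by [whole] the inequality holds everywhere, so equality
   at [x0] is a global maximum with value 0. *)
pose t := v x0 / psi x0.
have t0 : 0 < t.
  apply: (@lt_le_trans _ _ (v y / psi y)); first by rewrite divr_gt0// psiD//; exact: KD.
  by apply: hx0; rewrite inE.
have leK x : K x -> v x - t * psi x <= 0.
  move=> Kx; rewrite subr_le0 -ler_pdivrMr; last by apply: psiD; exact: KD.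
  by apply: hx0; rewrite inE.
have e0 : v x0 - t * psi x0 = 0 by rewrite /t divfK ?subrr// gt_eqF.
have := no_max t x0 t0 leK (KD _ Kx0).
by rewrite e0 ltxx => /(_ (whole t t0 leK)).
Qed.
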